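(* Let $G$ be an infinite discrete countable abelian group and let $(X,G)$ be a minimal $G$-system. Let $(H,G)$ be the maximal equicontinuous factor of $(X,G)$, $\pi:X\to H$ the factor map, and $\nu$ the Haar measure on $H$. Then there exists $K\in\mathbb{N}\cup\{\infty\}$ with $\log K\le h_{top}^*(X,G)$ (where $\log\infty=\infty$) such that $$\nu(\{y\in H:|\pi^{-1}(y)|=K\})=1.$$
   Context: A $G$-system $(X,G)$ is a compact metric space $(X,d)$ on which $G$ acts by homeomorphisms; it is minimal if every orbit is dense. A factor map between $G$-systems is a continuous surjection intertwining the actions. $(X,G)$ is equicontinuous if for every $\epsilon>0$ there is $\delta>0$ with $d(x,y)<\delta\Rightarrow d(gx,gy)<\epsilon$ for all $g\in G$. The maximal equicontinuous factor $(H,G)$ of $(X,G)$ is the quotient $X/S_{eq}$, where $S_{eq}$ is the smallest closed $G$-invariant equivalence relation on $X$ whose quotient system is equicontinuous; $\pi$ is the quotient map. Since $(H,G)$ is minimal and equicontinuous it has a unique $G$-invariant Borel probability measure $\nu$, called the Haar measure. Topological sequence entropy: for a sequence $\mathcal{A}=(g_n)_{n\ge1}$ in $G$ and a finite open cover $\mathcal{U}$ of $X$, $h_{top}^{\mathcal{A}}(G,\mathcal{U})=\limsup_{n\to\infty}\frac1n\log N(\bigvee_{i=1}^n g_i^{-1}\mathcal{U})$, where $N(\cdot)$ is the minimal cardinality of a subcover; $h_{top}^{\mathcal{A}}(X,G)=\sup_{\mathcal{U}}h_{top}^{\mathcal{A}}(G,\mathcal{U})$ over finite open covers, and $h_{top}^*(X,G)=\sup_{\mathcal{A}}h_{top}^{\mathcal{A}}(X,G)$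 over all sequences $\mathcal{A}$ in $G$. *)

(* Defs.v *)
From HB Require Import structures.
From mathcomp Require Import all_boot all_order all_algebra.
From mathcomp Require Import all_classical all_reals all_analysis.
Set Implicit Arguments. Unset Strict Implicit. Unset Printing Implicit Defensive.
Import Order.TTheory GRing.Theory Num.Theory.
Import numFieldNormedType.Exports.
Local Open Scope classical_set_scope.
Local Open Scope ring_scope.
Local Open Scope card_scope.

Definition is_action (G : zmodType) (T : Type) (act : G -> T -> T) : Prop :=
  (forall x, act 0 x = x) /\ (forall g h x, act (g + h) x = act g (act h x)).

Definition compact_metric (R : realType) (X : pseudoMetricType R) : Prop :=
  hausdorff_space X /\ compact [set: X].

(* (X,G) is a G-system: G acts on the compact metric space X by homeomorphisms
   (each act g is continuous, with continuous inverse act (-g)). *)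
Definition Gsystem (R : realType) (G : zmodType) (X : pseudoMetricType R)
  (act : G -> X -> X) : Prop :=
  compact_metric X /\ is_action act /\ (forall g, continuous (act g)).

Definition minimal_system (G : zmodType) (X : topologicalType)
  (act : G -> X -> X) : Prop :=
  forall x, closure (range (fun g => act g x)) = [set: X].

Definition equicontinuous_system (R : realType) (G : zmodType)
  (X : pseudoMetricType R) (act : G -> X -> X) : Prop :=
  forall eps : R, 0 < eps -> exists2 delta : R, 0 < delta &
    forall x y, ball x delta y -> forall g, ball (act g x) eps (act g y).

Definition factor_map (G : zmodType) (X Y : topologicalType)
  (actX : G -> X -> X) (actY : G -> Y -> Y) (f : X -> Y) : Prop :=
  continuous f /\ f @` [set: X] = [set: Y] /\
  (forall g x, f (actX g x) = actY g (f x)).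

(* The quotient of (X,G) by the relation Rel is an equicontinuous G-system:
   there is a G-system (Y,G) and a factor map f : X -> Y whose fibres are
   exactly the Rel-classes (so (Y,G) is conjugate to X/Rel), with (Y,G)
   equicontinuous. *)
Definition equicontinuous_quotient (R : realType) (G : zmodType)
  (X : pseudoMetricType R) (act : G -> X -> X) (Rel : X -> X -> Prop) : Prop :=
  exists (Y : pseudoMetricType R) (actY : G -> Y -> Y) (f : X -> Y),
    [/\ Gsystem actY, factor_map act actY f, equicontinuous_system actY &
        forall x x', f x = f x' <-> Rel x x'].

Definition eq_admissible (R : realType) (G : zmodType)
  (X : pseudoMetricType R) (act : G -> X -> X) (Rel : X -> X -> Prop) : Prop :=
  [/\ ((forall x, Rel x x) /\ (forall x y, Rel x y -> Rel y x)),
      (forall x y z, Rel x y -> Rel y z -> Rel x z),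
      closed [set p : X * X | Rel p.1 p.2],
      (forall g x y, Rel x y -> Rel (act g x) (act g y)) &
      equicontinuous_quotient act Rel].

Definition S_eq (R : realType) (G : zmodType) (X : pseudoMetricType R)
  (act : G -> X -> X) (x y : X) : Prop :=
  forall Rel : X -> X -> Prop, eq_admissible act Rel -> Rel x y.

(* (H,G) with factor map pi is the maximal equicontinuous factor of (X,G):
   it is a G-system, pi is a factor map, and the fibres of pi are exactly the
   S_eq-classes, i.e. (H,G) is (conjugate to) X / S_eq with pi the quotient map. *)
Definition max_equicontinuous_factor (R : realType) (G : zmodType)
  (X H : pseudoMetricType R) (act : G -> X -> X) (actH : G -> H -> H)
  (pi : X -> H) : Prop :=
  [/\ Gsystem actH, factor_map act actH pi &
      forall x x', pi x = pi x' <-> S_eq act x x'].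

Notation Borel T := (g_sigma_algebraType (@open T)).

Definition finite_open_cover (X : topologicalType) (U : set (set X)) : Prop :=
  [/\ finite_set U, (forall V, U V -> open V) & \bigcup_(V in U) V = [set: X]].

(* the join  \/_{i=1}^n g_i^{-1} U  for the sequence A = (g_1, g_2, ...)
   given as A : nat -> G with g_{i+1} = A i *)
Definition join_cover (G : zmodType) (X : Type) (act : G -> X -> X)
  (A : nat -> G) (n : nat) (U : set (set X)) : set (set X) :=
  (fun f : nat -> set X => \bigcap_(i in `I_n) (act (A i) @^-1` f i)) @`
    [set f : nat -> set X | forall i, U (f i)].

Definition Ncover (R : realType) (X : Type) (V : set (set X)) : \bar R :=
  ereal_inf [set (size s)%:R%:E | s in
    [set s : seq (set X) | (forall i, (i < size s)%N -> V (nth set0 s i)) /\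
       (forall x, exists2 i, (i < size s)%N & nth set0 s i x)]].

Definition hseq_cover (R : realType) (G : zmodType) (X : Type)
  (act : G -> X -> X) (A : nat -> G) (U : set (set X)) : \bar R :=
  limn_esup (fun n : nat =>
    ((n%:R)^-1 * ln (fine (Ncover R (join_cover act A n U))))%:E).

Definition hseq_top (R : realType) (G : zmodType) (X : topologicalType)
  (act : G -> X -> X) (A : nat -> G) : \bar R :=
  ereal_sup [set hseq_cover R act A U | U in [set U | finite_open_cover U]].

Definition hstar_top (R : realType) (G : zmodType) (X : topologicalType)
  (act : G -> X -> X) : \bar R :=
  ereal_sup (range (hseq_top R act)).

Definition logK (R : realType) (K : option nat) : \bar R :=
  match K with Some n => (ln (n%:R : R))%:E | None => +oo%E end.

Definition fibre_card (X H : Type) (pi : X -> H) (y : H) (K : option nat) : Prop :=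
  match K with
  | Some n => [set x | pi x = y] #= `I_n
  | None => infinite_set [set x | pi x = y]
  end.

(* Main.v *)
(* The sets of points of H whose fibre has at least n elements are countable
   unions of closed sets and G-invariant, so by ergodicity each has measure 0
   or 1, and K is the last n for which it has measure 1 (or infinity).

   Suppose that it has measure 1 for n = k. Then some closed set E of positive
   measure lies in the image of each of k open sets U_1, ..., U_k with pairwise
   disjoint closures, and the entropy bound follows from a sequence (g_i) such
   that every word w over {1, ..., k} is realised by a point x with
   g_i x in U_(w i).

   The key to the construction of (g_i) is Veech's fact that, for open W, N, C,
   the set of points moved into W by some g with g N meeting C is saturated for
   pi. With an invariant mean m on X, the open invariant set
   O = {(a, b) : g a in W and g b in C for some g} has sections O_a for which
   m(O_a) is lower semicontinuous and invariant in a, hence constant; so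
   m(O_a symdiff O_a') is a continuous invariant pseudometric in (a, a'), and it
   vanishes when pi a = pi a', as its quotient is equicontinuous. Consequently,
   finitely many open sets W_i can be moved by a single g so as to meet
   prescribed open sets V_i, as soon as pi V_i lies in the interior of pi W_i.

   The g_i are then chosen inductively: if the open cells realising the words of
   length n have images containing points gamma_w y_0, where the translates
   gamma_w^-1 E meet in positive measure, then for y in that intersection all
   gamma_w y lie in E, so the fibres over all of them meet every U_j. *)

Require Import Defs.
From HB Require Import structures.
From mathcomp Require Import all_boot all_order all_algebra.
From mathcomp Require Import all_classical all_reals all_analysis.
From mathcomp Require Import measurable_realfun lra.
Set Implicit Arguments. Unset Strict Implicit. Unset Printing Implicit Defensive.
Import Order.TTheory GRing.Theory Num.Theory.
Import numFieldNormedType.Exports.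
Local Open Scope classical_set_scope.
Local Open Scope ring_scope.
Local Open Scope card_scope.

(** * Topology and group actions *)

Lemma compact_finite_cover (T : topologicalType) (I : choiceType)
    (f : I -> set T) :
  compact [set: T] -> (forall i, open (f i)) -> (forall x, exists i, f i x) ->
  exists s : seq I, forall x, exists2 i, i \in s & f i x.
Proof.
move=> cT fo fT.
have [[x0 _]|T0] := pselect (exists x : T, True); last first.
  by exists [::] => x; exfalso; apply: T0; exists x.
pose T' : ptopologicalType := HB.pack (T : Type) T (isPointed.Build T x0).
have : @cover_compact T' [set: T] by rewrite -(@compact_cover T').
move=> /(_ I [set: I] f) [].
- by move=> i _; exact: fo.
- by move=> x _; have [i fx] := fT x; exists i.
- move=> D _ DT; exists (finmap.enum_fset D) => x.
  by have [i iD fx] := DT x Logic.I; exists i.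
Qed.

(** A finite Baire argument: either [O] lies in [C i], or the part of [O] outside [C i] is a
    nonempty open set covered by the rest of the list. *)
Lemma closed_cover_interior (T : topologicalType) (I : eqType)
    (C : I -> set T) (s : seq I) (O : set T) :
  (forall i, closed (C i)) -> open O -> O !=set0 ->
  (forall x, O x -> exists2 i, i \in s & C i x) ->
  exists2 i, i \in s & (C i)° !=set0.
Proof.
move=> cC; elim: s O => [|i s IH] O oO [x Ox] OC; first by have [] := OC x Ox.
have [[y [Oy Cy]]|OCi] := pselect ((O `&` ~` C i) !=set0).
  have oO' : open (O `&` ~` C i) by apply: openI => //; exact: closed_openC.
  have [||j js jC] := IH (O `&` ~` C i) oO'; first by exists y.
  - move=> z [Oz Cz]; have [j] := OC z Oz.
    by rewrite inE => /orP[/eqP->//|js Cjz]; exists j.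
  - by exists j => //; rewrite inE js orbT.
exists i; first by rewrite inE eqxx.
exists x; apply: filterS (open_nbhs_nbhs (conj oO Ox)) => z Oz.
by apply: contrapT => Cz; apply: OCi; exists z.
Qed.

Lemma open_forall (T : topologicalType) (I : finType) (f : I -> set T) :
  (forall i, open (f i)) -> open [set x | forall i, f i x].
Proof.
move=> fo; rewrite openE => x fx; rewrite /interior/=.
by apply: filter_forall => i; apply: open_nbhs_nbhs; split.
Qed.

Lemma closed_forall (T : topologicalType) (I : Type) (f : I -> set T) :
  (forall i, closed (f i)) -> closed [set x | forall i, f i x].
Proof.
move=> fc; rewrite (_ : mkset _ = \bigcap_i f i); first exact: closed_bigI.
by apply/seteqP; split=> x fx i; [move=> _; exact: fx|exact: fx i Logic.I].
Qed.

Lemma bump_exists (R : realType) (X : uniformType) (U : set X) (x : X) :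
  open U -> U x ->
  exists f : X -> R, [/\ continuous f, forall y, 0 <= f y <= 1, f x = 1 &
    forall y, ~ U y -> f y = 0].
Proof.
move=> oU Ux.
have : @uniform_separator X [set x] (~` U).
  apply: (@uniform_completely_regular R X) => /=; first exact: open_closedC.
  by move=> /(_ Ux).
move=> /(@uniform_separatorP X R)[f [cf f01 f0 f1]].
exists (fun y => 1 - f y); split.
- by move=> y; apply: cvgB; [exact: cvg_cst|exact: cf].
- move=> y; have /f01 : range f (f y) by exists y.
  by rewrite /= in_itv/= => /andP[? ?]; apply/andP; split; lra.
- by rewrite (_ : f x = 0) ?subr0//; apply: f0; exists x.
- by move=> y nUy; rewrite (_ : f y = 1) ?subrr//; apply: f1; exists y.
Qed.

Section action.
Variables (G : zmodType) (T : Type) (act : G -> T -> T).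
Hypothesis hact : is_action act.

Lemma act0 x : act 0 x = x. Proof. exact: hact.1. Qed.

Lemma actD g h x : act (g + h) x = act g (act h x). Proof. exact: hact.2. Qed.

Lemma actC g h x : act g (act h x) = act h (act g x).
Proof. by rewrite -!actD addrC. Qed.

Lemma actK g x : act (- g) (act g x) = x.
Proof. by rewrite -actD addNr act0. Qed.

Lemma actNK g x : act g (act (- g) x) = x.
Proof. by rewrite -actD subrr act0. Qed.

End action.

Section minimal.
Variables (G : zmodType) (X : topologicalType) (act : G -> X -> X).
Hypotheses (hact : is_action act) (cact : forall g, continuous (act g)).
Hypothesis mact : minimal_system act.

Lemma orbit_meets (U : set X) (x : X) :
  open U -> U !=set0 -> exists g, U (act g x).
Proof.
move=> oU [u Uu].
have : closure (range (fun g => act g x)) u by rewrite mact.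
by move=> /(_ U (open_nbhs_nbhs (conj oU Uu)))[_ [[g _ <-] Ug]]; exists g.
Qed.

Lemma open_act_preimage g (U : set X) : open U -> open (act g @^-1` U).
Proof. by move=> oU; apply: open_comp => // x _; exact: cact. Qed.

Lemma syndetic (U : set X) : compact [set: X] -> open U -> U !=set0 ->
  exists s : seq G, forall x, exists2 g, g \in s & U (act g x).
Proof.
move=> cX oU U0.
apply: (@compact_finite_cover _ _ (fun g => act g @^-1` U)) => //.
  by move=> g; exact: open_act_preimage.
by move=> x; exact: orbit_meets.
Qed.

End minimal.

Section factor.
Variables (R : realType) (G : zmodType) (X H : pseudoMetricType R).
Variables (act : G -> X -> X) (actH : G -> H -> H) (pi : X -> H).
Hypotheses (hX : Gsystem act) (hH : Gsystem actH) (mX : minimal_system act).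
Hypothesis fpi : factor_map act actH pi.

Let surj y : exists x, pi x = y.
Proof.
have [_ [piT _]] := fpi.
by have : [set: H] y by []; rewrite -piT => -[x _ <-]; exists x.
Qed.

Lemma factor_minimal : minimal_system actH.
Proof.
move=> y; have [x <-] := surj y.
apply/seteqP; split=> // z _ U /= Uz.
have [z' z'E] := surj z; rewrite -z'E in Uz.
have [pic [_ pie]] := fpi.
have : nbhs z' (pi @^-1` U) by exact: pic.
rewrite nbhsE => -[V [oV Vz'] VU].
have [g Vg] := @orbit_meets _ _ _ mX V x oV (ex_intro _ z' Vz').
by exists (actH g (pi x)); split; [exists g|rewrite -pie; exact: VU].
Qed.

Lemma factor_image_closed (C : set X) : closed C -> closed (pi @` C).
Proof.
move=> clC; apply: compact_closed; first exact: hH.1.1.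
apply: continuous_compact; last first.
  by apply: (subclosed_compact clC hX.1.2).
by apply: continuous_subspaceT; exact: fpi.1.
Qed.

(** By syndeticity, finitely many translates of a closed set inside [V] cover [X]. Their images are
    closed and cover [H], so one of them has interior, which is then translated back. *)
Lemma factor_semi_open (V : set X) : open V -> V !=set0 -> (pi @` V)° !=set0.
Proof.
move=> oV [v Vv]; have [[_ cX] [aX cact]] := hX; have [_ [aH cH]] := hH.
have [pic [_ pie]] := fpi.
have [C Cv CV] : exists2 C, nbhs v C & closure C `<=` V.
  have Vn : nbhs v V by exact: open_nbhs_nbhs.
  exact: (@uniform_regular X v V Vn).
have [s sP] := @syndetic _ _ _ cact mX (C°) cX (@open_interior _ C)
   (ex_intro _ v (nbhs_singleton (nbhs_interior Cv))).
have [||y _|g gs [y yP]] := @closed_cover_interior H G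
  (fun g => pi @` (act g @^-1` closure C)) s setT _ (@openT _).
- move=> g; apply: factor_image_closed; apply: closed_comp => [x _|].
    exact: cact.
  exact: closed_closure.
- by exists (pi v).
- have [x <-] := surj y; have [g gs gC] := sP x; exists g => //.
  by exists x => //=; apply: subset_closure; exact: interior_subset gC.
- exists (actH g y).
  have : nbhs (actH g y) (actH (- g) @^-1` (pi @` (act g @^-1` closure C))).
    by apply: cH; rewrite actK.
  apply: filterS => z [x Cx xz]; exists (act g x); first exact: CV.
  by rewrite pie xz actNK.
Qed.

End factor.

(** * Invariant means on abelian groups *)

Section Folner.
Variables (R : realType) (G : zmodType).
Implicit Types (f : G -> R) (s : seq G).

Definition fbounded f := exists B : R, forall h, `|f h| <= B.

(** To accommodate [g0], the list [s] is replaced by all sums [g0 *+ k + h] with k <= n, counted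
    with multiplicity. For [g0] the difference telescopes to two blocks of length [size s]; for the
    earlier [g], commutativity lets the old bound be applied to each block. *)
Lemma folner_list (l : seq G) (n : nat) :
  exists2 s : seq G, (0 < size s)%N &
    forall g, g \in l -> forall f (B : R), (forall h, `|f h| <= B) ->
      `|\sum_(h <- s) f (g + h) - \sum_(h <- s) f h| <=
        2 * B * (size s)%:R / n.+1%:R.
Proof.
elim: l => [|g0 l [s s_gt0 sP]]; first by exists [:: 0].
exists [seq g0 *+ k + h | k <- iota 0 n.+1, h <- s].
  by rewrite size_allpairs size_iota muln_gt0.
have bs f : \sum_(h <- [seq g0 *+ k + h | k <- iota 0 n.+1, h <- s]) f h =
    \sum_(0 <= k < n.+1) \sum_(h <- s) f (g0 *+ k + h).
  by rewrite big_allpairs_dep /index_iota subn0.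
rewrite size_allpairs size_iota => g; rewrite inE => /orP[/eqP->{g}|gl] f B fB.
  rewrite !bs -sumrB.
  rewrite (eq_bigr (fun k => \sum_(h <- s) f (g0 *+ k.+1 + h)
            - \sum_(h <- s) f (g0 *+ k + h))); last first.
    move=> k _; congr (_ - _); apply: eq_bigr => h _.
    by rewrite mulrS !addrA.
  rewrite telescope_sumr// mulr0n.
  rewrite natrM (mulrC n.+1%:R) mulrA mulfK ?pnatr_eq0//.
  apply: le_trans (ler_normB _ _) _.
  have le1 (g : G) : `|\sum_(h <- s) f (g + h)| <= B * (size s)%:R.
    apply: le_trans (ler_norm_sum _ _ _) _.
    apply: (le_trans (ler_sum _ (fun h _ => fB (g + h)))).
    by rewrite big_const_seq count_predT iter_addr addr0 mulr_natr.
  rewrite -mulrA mulrDl !mul1r; exact: lerD.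
rewrite !bs -sumrB.
apply: le_trans (ler_norm_sum _ _ _) _.
apply: (@le_trans _ _ (\sum_(0 <= k < n.+1) (2 * B * (size s)%:R / n.+1%:R))).
  apply: ler_sum => k _.
  have := sP g gl (fun h => f (g0 *+ k + h)) B (fun h => fB _).
  congr (`|_ - _| <= _); apply: eq_bigr => h _.
  by rewrite addrCA.
rewrite sumr_const_nat subn0 -[leLHS]mulr_natr divfK ?pnatr_eq0// natrM (mulrC n.+1%:R) mulrA mulfK ?pnatr_eq0//.
Qed.

Definition avg s f := (\sum_(h <- s) f h) / (size s)%:R.

(** The field [mean_approx] remembers that [m] is a limit of finite averages, so that comparisons of
    means can be brought back to a single finite list. *)
Record is_mean (m : (G -> R) -> R) : Prop := IsMean {
  meanD : forall f1 f2, fbounded f1 -> fbounded f2 ->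
    m (fun g => f1 g + f2 g) = m f1 + m f2;
  mean_le : forall f1 f2, fbounded f1 -> fbounded f2 ->
    (forall g, f1 g <= f2 g) -> m f1 <= m f2;
  mean_cst : forall c, m (fun=> c) = c;
  mean_shift : forall h f, fbounded f -> m (fun g => f (h + g)) = m f;
  mean_approx : forall (I : finType) (f : I -> G -> R) (e : R),
    (forall i, fbounded (f i)) -> 0 < e ->
    exists2 s : seq G, (0 < size s)%N & forall i, `|avg s (f i) - m (f i)| < e
}.

End Folner.

Lemma ultra_fmap (T U : Type) (f : T -> U) (F : set_system T) :
  UltraFilter F -> UltraFilter (f @ F).
Proof.
move=> FU; split; first exact: fmap_proper_filter.
move=> G GF FG; rewrite eqEsubset; split=> // A GA.
have [//|nA] := in_ultra_setVsetC (f @^-1` A) FU.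
have GnA : G (~` A) by exact: FG.
by have /filter_ex[? []] : G (A `&` ~` A) by exact: filterI.
Qed.

(** The mean is the limit of averages over Folner lists along an ultrafilter finer than [\oo]. As
    [l n] contains the elements with code below n, the list [s n] is almost invariant under each of
    them. *)
Lemma mean_exists (R : realType) (G : countZmodType) :
  exists m : (G -> R) -> R, is_mean m.
Proof.
pose l n := pmap (@unpickle G) (iota 0 n).
have lP g n : (pickle g < n)%N -> g \in l n.
  move=> gn; rewrite mem_pmap; apply/mapP; exists (pickle g); last by rewrite pickleK.
  by rewrite mem_iota.
pose s n := s2val (cid2 (@folner_list R G (l n) n)).
have s0 n : (0 < size (s n))%N by exact: s2valP (cid2 (folner_list R (l n) n)).
have sP n := s2valP' (cid2 (@folner_list R G (l n) n)); rewrite -/(s _) in sP.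
have [U [UU Uoo]] := @ultraFilterLemma _ (\oo : set_system nat) _.
have FU := @ultra_proper _ _ UU.
have size0 n : 0 < (size (s n))%:R :> R by rewrite ltr0n.
have avgB n (f : G -> R) (B : R) : (forall h, `|f h| <= B) -> `|avg (s n) f| <= B.
  move=> fB; rewrite /avg normrM normfV normr_nat ler_pdivrMr//.
  apply: le_trans (ler_norm_sum _ _ _) _.
  apply: (le_trans (ler_sum _ (fun h _ => fB h))).
  by rewrite big_const_seq count_predT iter_addr addr0 mulr_natr.
have cvgU (f : G -> R) : fbounded f -> cvg ((fun n => avg (s n) f) @ U).
  move=> [B fB].
  have cK : compact `[- B, B]%classic := @segment_compact R (-B) B.
  move: cK; rewrite compact_ultra => /(_ ((fun n => avg (s n) f) @ U)).
  case.
  - exact: ultra_fmap.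
  - by apply: (@filterE _ U) => n /=; rewrite in_itv/= -ler_norml; exact: avgB.
  - by move=> x [_ xP]; apply/cvg_ex; exists x.
pose m (f : G -> R) : R := lim ((fun n => avg (s n) f) @ U).
have mcvg (f : G -> R) : fbounded f -> (fun n => avg (s n) f) @ U --> m f.
  by move=> /cvgU.
have mE (f : G -> R) (c : R) : fbounded f -> (fun n => avg (s n) f) @ U --> c -> m f = c.
  by move=> _ /cvg_lim; apply; exact: Rhausdorff.
exists m; split.
- move=> f1 f2 b1 b2; apply: mE.
    case: b1 => B1 b1; case: b2 => B2 b2; exists (B1 + B2) => h.
    by apply: le_trans (ler_normD _ _) _; exact: lerD.
  rewrite (_ : (fun n => _) = (fun n => avg (s n) f1 + avg (s n) f2)); last first.
    by apply/funext => n; rewrite /avg -mulrDl -big_split.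
  by apply: cvgD; exact: mcvg.
- move=> f1 f2 b1 b2 f12; apply: (ler_cvg_to (mcvg _ b1) (mcvg _ b2)).
  near=> n; rewrite /avg ler_wpM2r ?invr_ge0//.
  exact: ler_sum.
- move=> c; apply: mE; first by exists `|c|.
  rewrite (_ : (fun n => _) = (fun n => c)); first exact: cvg_cst.
  apply/funext => n; rewrite /avg big_const_seq count_predT iter_addr addr0.
  by rewrite -[c *+ _]mulr_natr mulfK// gt_eqF.
- move=> h f bf; have [B fB] := bf.
  have bf' : fbounded (fun g => f (h + g)) by exists B.
  apply: mE => //.
  rewrite (_ : (fun n => _) = (fun n => (avg (s n) (fun g => f (h + g)) - avg (s n) f)
       + avg (s n) f)); last by apply/funext => n; rewrite subrK.
  rewrite -[X in _ --> X]add0r; apply: cvgD; last exact: mcvg.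
  have cv0 : (fun n : nat => 2 * B * n.+1%:R^-1 : R) @ \oo --> (0 : R).
    rewrite -[X in _ --> X](mulr0 (2 * B)); apply: cvgM; first exact: cvg_cst.
    exact: cvg_harmonic.
  have {}cv0 : (fun n : nat => 2 * B * n.+1%:R^-1 : R) @ U --> (0 : R).
    by apply: cvg_trans cv0; exact: cvg_fmap2.
  apply/norm_cvg0P.
  apply: (@squeeze_cvgr _ _ _ _ (fun=> 0) (fun n : nat => 2 * B * n.+1%:R^-1)) => //; last exact: cvg_cst.
  apply: Uoo; exists (pickle h).+1 => // n /= hn.
  rewrite normr_ge0/= /avg -mulrBl normrM normfV normr_nat.
  rewrite ler_pdivrMr// mulrAC; exact: sP (lP _ _ hn) _ _ fB.
- move=> I f e fb e0.
  have : \forall n \near U, forall i : I, `|avg (s n) (f i) - m (f i)| < e.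
    apply: filter_forall => i.
    by have /cvgrPdistC_lt := mcvg _ (fb i); apply.
  by move=> /filter_ex[n nP]; exists (s n).
Unshelve. all: by end_near. Qed.

(** * Quotients by invariant pseudometrics *)

Record pdist (R : realType) (X : choiceType) := PDist {
  pd :> X -> X -> R;
  pdxx : forall x, pd x x = 0;
  pdC : forall x y, pd x y = pd y x;
  pdD : forall y x z, pd x z <= pd x y + pd y z
}.

Section quotient.
Variables (R : realType) (X : choiceType) (D : pdist R X).

Lemma pd_ge0 x y : 0 <= D x y.
Proof. by have := pdD D y x x; rewrite pdxx (pdC D y x); lra. Qed.

Lemma pd_eq0r x y z : D x y = 0 -> D z x = D z y.
Proof.
move=> xy; have := pdD D x z y; have := pdD D y z x.
by rewrite (pdC D y x) xy; lra.
Qed.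

Definition pd_rep x := xget x [set y | D x y = 0].

Lemma pd_repE x : D x (pd_rep x) = 0.
Proof.
suff : [set y | D x y = 0] (pd_rep x) by [].
by apply: (xgetPex x); exists x; exact: pdxx.
Qed.

Lemma eq_pd_rep x y : D x y = 0 -> pd_rep x = pd_rep y.
Proof.
move=> xy; rewrite /pd_rep.
have -> : [set z | D x z = 0] = [set z | D y z = 0].
  by apply/seteqP; split=> z /=; rewrite (pdC D x) (pdC D y) (pd_eq0r z xy).
(* The two sides differ only in the default value of [xget], which is never returned because the
   class is nonempty. *)
rewrite /xget; case: pselect => // H; exfalso; apply: H; exists y.
by apply/asboolP; exact: pdxx.
Qed.

(* The quotient is realised by the canonical representatives of the classes. *)
Definition quot := {x : X | pd_rep x == x}.
HB.instance Definition _ := Choice.on quot.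

Definition qball (p : quot) (e : R) (q : quot) := D (val p) (val q) < e.
Definition qent := entourage_ qball.

Let qball_center p e : 0 < e -> qball p e p.
Proof. by rewrite /qball pdxx. Qed.

Let qball_sym p q e : qball p e q -> qball q e p.
Proof. by rewrite /qball pdC. Qed.

Let qball_triangle p q r e1 e2 :
  qball p e1 q -> qball q e2 r -> qball p (e1 + e2) r.
Proof.
by rewrite /qball => pq qr; apply: le_lt_trans (pdD D (val q) _ _) (ltrD pq qr).
Qed.

HB.instance Definition _ := hasNbhs.Build quot (nbhs_ qent).
HB.instance Definition _ := Nbhs_isPseudoMetric.Build R quot erefl
  qball_center qball_sym qball_triangle erefl.

Lemma qballE (p q : quot) e : ball p e q = (D (val p) (val q) < e) :> Prop.
Proof. by []. Qed.

Lemma pd_rep_idem x : pd_rep (pd_rep x) == pd_rep x.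
Proof. by apply/eqP/eq_pd_rep; rewrite pdC pd_repE. Qed.

Definition qproj x : quot := exist _ (pd_rep x) (pd_rep_idem x).

Lemma val_qproj x : D x (val (qproj x)) = 0. Proof. exact: pd_repE. Qed.

Lemma pd_qproj x y : D (val (qproj x)) (val (qproj y)) = D x y.
Proof. by rewrite -(pd_eq0r _ (val_qproj y)) pdC -(pd_eq0r _ (val_qproj x)) pdC. Qed.

Lemma qprojK (p : quot) : qproj (val p) = p.
Proof. by apply/val_inj/eqP; exact: (valP p). Qed.

Lemma qproj_eq x y : qproj x = qproj y <-> D x y = 0.
Proof.
split=> [xy|xy]; first by rewrite -pd_qproj xy pdxx.
by apply/val_inj; exact: eq_pd_rep.
Qed.

Lemma quot_hausdorff : hausdorff_space quot.
Proof.
move=> p q pq; rewrite -(qprojK p) -(qprojK q); apply/qproj_eq/eqP.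
rewrite eq_le pd_ge0 andbT leNgt; apply/negP => d0.
have d20 : 0 < D (val p) (val q) / 2 by rewrite divr_gt0.
have [r [pr qr]] := pq _ _ (nbhsx_ballx p _ d20) (nbhsx_ballx q _ d20).
rewrite !qballE in pr qr.
by have := pdD D (val r) (val p) (val q); rewrite (pdC D (val r)); lra.
Qed.

End quotient.

Section equicontinuous_quotient.
Variables (R : realType) (G : zmodType) (X : pseudoMetricType R).
Variables (act : G -> X -> X) (hX : Gsystem act) (D : pdist R X).
Hypothesis Dinv : forall g x y, D (act g x) (act g y) = D x y.
Hypothesis Dnear : forall x e, 0 < e -> \forall y \near x, D x y < e.

(** Vanishing of [D] is an admissible relation: [Dnear] makes the projection to [quot D] continuous,
    so the quotient is compact, and [G] acts on it by isometries. [S_eq] is contained in every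
    admissible relation. *)
Lemma S_eq_pdist x y : S_eq act x y -> D x y = 0.
Proof.
have [[hausX cX] [aX cact]] := hX.
pose q := @qproj R X D; pose actq g (p : quot D) := q (act g (val p)).
have actqE g x' : actq g (q x') = q (act g x').
  by apply/qproj_eq; rewrite Dinv pdC; exact: val_qproj.
have qc : continuous q.
  move=> x0; apply/cvg_ballP => e e0; apply: filterS (Dnear x0 e0) => z.
  by rewrite qballE pd_qproj.
move=> /(_ (fun x y => D x y = 0)); apply; split.
- by split=> [x0|x0 y0]; [exact: pdxx|rewrite pdC].
- by move=> x0 y0 z0 xy yz; rewrite -(pd_eq0r x0 yz).
- move=> [a b] /= ab; apply/eqP; rewrite eq_le pd_ge0 andbT leNgt.
  apply/negP => d0.
  have d20 : 0 < D a b / 2 by rewrite divr_gt0.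
  have [|[a' b'] /= [ab0 [/= aa' bb']]] :=
    ab ([set a' | D a a' < D a b / 2] `*` [set b' | D b b' < D a b / 2]).
    by exists ([set a' | D a a' < D a b / 2], [set b' | D b b' < D a b / 2]);
      [split; exact: Dnear|].
  have := pdD D a' a b; have := pdD D b' a' b; rewrite ab0 (pdC D b'); lra.
- by move=> g x0 y0; rewrite Dinv.
exists (quot D), actq, q; split.
- split; [split|split; [split|]].
  + exact: quot_hausdorff.
  + have <- : q @` [set: X] = [set: quot D].
      by apply/seteqP; split=> // p _; exists (val p) => //; exact: qprojK.
    by apply: continuous_compact => //; exact: continuous_subspaceT.
  + by move=> p; rewrite /actq act0//; exact: qprojK.
  + by move=> g h p; rewrite [actq h p]/actq actqE /actq actD.
  + move=> g p; apply/(@cvg_ballP _ _ _ _ (nbhs_filter p)) => e e0; apply/nbhs_ballP; exists e => // r.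
    by rewrite !qballE pd_qproj Dinv.
- split=> //; split; last by move=> g x0; rewrite actqE.
  by apply/seteqP; split=> // p _; exists (val p) => //; exact: qprojK.
- move=> e e0; exists e => // p r pr g.
  by move: pr; rewrite !qballE pd_qproj Dinv.
- by move=> x0 y0; exact: qproj_eq.
Qed.

End equicontinuous_quotient.

(** * Fibres of the maximal equicontinuous factor *)

Section saturation.
Variables (R : realType) (G : zmodType) (m : (G -> R) -> R).
Hypothesis mean_m : is_mean m.
Variables (X : pseudoMetricType R) (act : G -> X -> X).
Hypotheses (hX : Gsystem act) (mX : minimal_system act).
Variable z : X.

Let aX : is_action act. Proof. exact: hX.2.1. Qed.
Let cact : forall g, continuous (act g). Proof. exact: hX.2.2. Qed.

(** An invariant positive functional on the bounded functions on [X], taking the place of an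
    invariant measure. *)
Definition orbit_mean (f : X -> R) := m (fun g => f (act g z)).

Local Notation M := orbit_mean.

Definition xbounded (f : X -> R) := exists B : R, forall t, `|f t| <= B.

Let xb f : xbounded f -> fbounded (fun g => f (act g z)).
Proof. by case=> B fB; exists B. Qed.

Let xb01 (f : X -> R) : (forall t, 0 <= f t <= 1) -> xbounded f.
Proof. by move=> f01; exists 1 => t; have /andP[? ?] := f01 t; rewrite ger0_norm. Qed.

Let xbD f g : xbounded f -> xbounded g -> xbounded (fun t => f t + g t).
Proof.
move=> [B fB] [C gC]; exists (B + C) => t.
by apply: le_trans (ler_normD _ _) _; exact: lerD.
Qed.

Let xbc c : xbounded (fun=> c). Proof. by exists `|c|. Qed.

Let MD f g : xbounded f -> xbounded g -> M (fun t => f t + g t) = M f + M g.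
Proof. by move=> /xb bf /xb bg; rewrite /M (meanD mean_m). Qed.

Let M_le f g : xbounded f -> xbounded g -> (forall t, f t <= g t) -> M f <= M g.
Proof. by move=> /xb bf /xb bg fg; apply: (mean_le mean_m) => // h. Qed.

Let Mc c : M (fun=> c) = c. Proof. exact: (mean_cst mean_m). Qed.

Let M_act h f : xbounded f -> M (f \o act h) = M f.
Proof.
move=> /xb bf; rewrite /M -(mean_shift mean_m h bf); congr (m _).
by apply/funext => g /=; rewrite actD.
Qed.

(** By syndeticity, finitely many translates of [f] add up to at least 1/2 everywhere, and each has
    the same mean as [f]. *)
Lemma orbit_mean_gt0 (f : X -> R) b : continuous f ->
  (forall t, 0 <= f t <= 1) -> f b = 1 -> 0 < M f.
Proof.
move=> cf f01 fb.
pose U := [set t | 2^-1 < f t].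
have oU : open U.
  by apply: (@open_comp _ _ f [set r | 2^-1 < r]) => // t _; exact: cf.
have Ub : U b by rewrite /U/= fb invf_lt1// ltr1n.
have [s sP] := syndetic cact mX hX.1.2 oU (ex_intro _ b Ub).
have bfs (l : seq G) : xbounded (fun t => \sum_(g <- l) f (act g t)).
  elim: l => [|g l IH].
    by under eq_fun do rewrite big_nil.
  under eq_fun do rewrite big_cons.
  by apply: xbD => //; apply: xb01 => t.
have Ms : M (fun t => \sum_(g <- s) f (act g t)) = M f *+ size s.
  elim: s {sP} => [|g s IH].
    by under eq_fun do rewrite big_nil; rewrite mulr0n; exact: Mc.
  under eq_fun do rewrite big_cons.
  rewrite MD//; last by apply: xb01 => t.
  by rewrite IH mulrS; congr (_ + _); apply: (@M_act g); exact: xb01.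
have : 2^-1 <= M f *+ size s.
  rewrite -Ms -[leLHS]Mc; apply: M_le => // t.
  have [g gs gU] := sP t; apply: (le_trans (ltW gU)).
  rewrite (big_rem g)//= lerDl sumr_ge0// => h _.
  by have /andP[] := f01 (act h t).
apply: contraTT; rewrite -leNgt -ltNge => Mf0.
by apply: le_lt_trans (_ : 0 < _); rewrite ?invr_gt0//; exact: mulrn_wle0.
Qed.

Section pseudometric.
Variables (u v : X -> R).
Hypotheses (cu : continuous u) (cv : continuous v).
Hypotheses (u01 : forall t, 0 <= u t <= 1) (v01 : forall t, 0 <= v t <= 1).
Implicit Types (F : seq G) (a b c t : X).

(* Finite stages of the function sup_g min (u (g a), v (g t)); its mean in [t]
   plays the role of a measure of {t | exists g, u (g a), v (g t) > 0}. *)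
Definition Phi F a t : R :=
  foldr (fun g r => Num.max (Num.min (u (act g a)) (v (act g t))) r) 0 F.

Lemma Phi_le F a t r : (Phi F a t <= r) =
  (0 <= r) && all (fun g => Num.min (u (act g a)) (v (act g t)) <= r) F.
Proof.
elim: F => [|g F IH] /=; first by rewrite andbT.
by rewrite ge_max IH andbCA.
Qed.

Lemma Phi01 F a t : 0 <= Phi F a t <= 1.
Proof.
apply/andP; split; last first.
  rewrite Phi_le ler01/=; apply/allP => g _; rewrite ge_min.
  by have /andP[_ ->] := u01 (act g a).
by have := lexx (Phi F a t); rewrite {1}Phi_le => /andP[].
Qed.

Lemma Phi_sub F F' a t : {subset F <= F'} -> Phi F a t <= Phi F' a t.
Proof.
move=> FF'; have := lexx (Phi F' a t); rewrite {1}Phi_le => /andP[p0 /allP pF].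
by rewrite Phi_le p0/=; apply/allP => g /FF'; exact: pF.
Qed.

(** Only the finitely many values [u (act g a)] depend on [a], and min and max are 1-Lipschitz in
    them, which gives uniformity in [t]. *)
Lemma Phi_near F a (e : R) : 0 < e ->
  \forall b \near a, forall t, Phi F a t <= Phi F b t + e.
Proof.
move=> e0; elim: F => [|g F IH]; first by near=> b => t /=; rewrite add0r ltW.
have ug : \forall b \near a, u (act g a) <= u (act g b) + e.
  have : (u \o act g) @ a --> u (act g a).
    by apply: continuous_comp; [exact: cact|exact: cu].
  move=> /cvgrPdist_lt/(_ e e0); apply: filterS => b /=.
  by rewrite ltr_norml => /andP[? ?]; lra.
near=> b => t.
have ub : u (act g a) <= u (act g b) + e by near: b.
have Fb : Phi F a t <= Phi F b t + e by move: t; near: b.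
rewrite /= /Num.min; do ![case: ifPn; rewrite -?leNgt => ?];
  by rewrite /Num.max; do ![case: ifPn; rewrite -?leNgt => ?]; lra.
Unshelve. all: by end_near. Qed.

(** The maximum corresponds to the union of the sections at [a] and at [b]. *)
Definition Psi F a b t := Num.max (Phi F a t) (Phi F b t).

Let Psi01 F a b t : 0 <= Psi F a b t <= 1.
Proof.
have /andP[a0 a1] := Phi01 F a t; have /andP[b0 b1] := Phi01 F b t.
by rewrite /Psi le_max a0/= ge_max a1.
Qed.

Let xbPsi F a b : xbounded (Psi F a b). Proof. exact: xb01. Qed.

Let MPsi F a b := M (Psi F a b).

Let MPsi1 F a b : MPsi F a b <= 1.
Proof. by rewrite -[leRHS]Mc; apply: M_le => // t; have /andP[] := Psi01 F a b t. Qed.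

(* [ovl a b - ovl a a] is half of the L1-distance between the suprema at [a]
   and at [b], because [ovl a a] does not depend on [a]. *)
Definition ovl a b := sup (range (fun F => M (Psi F a b))).

Let ovl_has_sup a b : has_sup (range (fun F => M (Psi F a b))).
Proof.
split; first by exists (MPsi [::] a b); exists [::].
by exists 1 => _ [F _ <-]; exact: MPsi1.
Qed.

Let ovl_ub F a b : MPsi F a b <= ovl a b.
Proof. by have [_ ub] := ovl_has_sup a b; apply: (ub_le_sup ub); exists F. Qed.

Let ovl_adh a b (e : R) : 0 < e -> exists F, ovl a b - e < MPsi F a b.
Proof.
by move=> e0; have [_ [F _ <-] ?] := sup_adherent e0 (ovl_has_sup a b); exists F.
Qed.

Let ovl_le a b r : (forall F, MPsi F a b <= r) -> ovl a b <= r.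
Proof.
move=> Fr; have [ne _] := ovl_has_sup a b; apply: (ge_sup ne).
by move=> _ [F _ <-]; exact: Fr.
Qed.

Let ovlC a b : ovl a b = ovl b a.
Proof.
have PsiC F : Psi F a b = Psi F b a by apply/funext => t; rewrite /Psi maxC.
by rewrite /ovl; under eq_fun do rewrite PsiC.
Qed.

Let MPsi_sub F F' a b : {subset F <= F'} -> MPsi F a b <= MPsi F' a b.
Proof.
move=> FF'; apply: M_le => // t; rewrite /Psi ge_max !le_max.
by rewrite !(Phi_sub _ _ FF') orbT.
Qed.

Let Phi_act F h a t : Phi F (act h a) (act h t) = Phi [seq g + h | g <- F] a t.
Proof. by elim: F => //= g F ->; rewrite !(actD aX). Qed.

Let ovl_act_le h a b : ovl (act h a) (act h b) <= ovl a b.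
Proof.
apply: ovl_le => F; rewrite /MPsi -(M_act h)//.
rewrite (_ : _ \o _ = Psi [seq g + h | g <- F] a b); first exact: ovl_ub.
by apply/funext => t; rewrite /Psi/= !Phi_act.
Qed.

Let ovl_act h a b : ovl (act h a) (act h b) = ovl a b.
Proof.
apply/eqP; rewrite eq_le ovl_act_le/=.
by have := ovl_act_le (- h) (act h a) (act h b); rewrite !actK.
Qed.

(* [a |-> ovl a a] is lower semicontinuous and invariant, hence constant. *)
Let ovl_diag a b : ovl a a <= ovl b b.
Proof.
rewrite leNgt; apply/negP => ba.
pose e := (ovl a a - ovl b b) / 3; have e0 : 0 < e by rewrite /e; lra.
have [F aF] := ovl_adh a a e0.
have : nbhs a [set b | forall t, Phi F a t <= Phi F b t + e] by exact: Phi_near.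
rewrite nbhsE => -[U [oU Ua] UP].
have [h Uh] := orbit_meets mX b oU (ex_intro _ a Ua).
have := ovl_ub F (act h b) (act h b); rewrite ovl_act.
have : MPsi F a a <= MPsi F (act h b) (act h b) + e.
  rewrite -[X in _ <= _ + X]Mc -MD//; apply: M_le => //; first exact: xbD.
  by move=> t; rewrite /Psi !maxxx; exact: (UP _ Uh).
by move: aF; rewrite /e; lra.
Qed.

(** The maximum and the minimum of two numbers add up to their sum. For b near a, the minimum of
    [Phi F' a] and [Phi F' b] is at least [Phi F a - d], whose mean is almost [ovl a a]; hence the
    maximum has mean little above [ovl a a]. *)
Let ovl_near a (e : R) : 0 < e -> \forall b \near a, ovl a b < ovl a a + e.
Proof.
move=> e0; pose d := e / 3; have d0 : 0 < d by rewrite /d; lra.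
have [F aF] := ovl_adh a a d0.
have := Phi_near F a d0; apply: filterS => b ab.
apply: (@le_lt_trans _ _ (ovl a a + 2 * d)); last by rewrite /d; lra.
apply: ovl_le => F1; pose F' := F1 ++ F.
have F1F' : {subset F1 <= F'} by move=> g; rewrite mem_cat => ->.
have FF' : {subset F <= F'} by move=> g; rewrite mem_cat => ->; rewrite orbT.
apply: (le_trans (MPsi_sub a b F1F')).
have : MPsi F' a b + MPsi F a a <= MPsi F' a a + MPsi F' b b + d.
  rewrite -[X in _ <= _ + X]Mc -!MD//; last exact: xbD.
  apply: M_le; [exact: xbD|by do 2 apply: xbD => //|] => t.
  have := ab t; have := Phi_sub a t FF'; have := Phi_sub b t FF'.
  by rewrite /Psi/= !maxxx /Num.max; case: ifP => _; lra.
have := ovl_ub F' a a; have := ovl_ub F' b b; have := ovl_diag b a.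
by move: aF; lra.
Qed.

(** Pointwise, max(p, r) + q <= max(p, q) + max(q, r), applied at a common finite stage. Subtracting
    the constant diagonal turns this into the triangle inequality. *)
Let ovl_tri b a c : ovl a c + ovl b b <= ovl a b + ovl b c.
Proof.
apply/ler_addgt0Pr => e e0; pose d := e / 2; have d0 : 0 < d by rewrite /d; lra.
have [F1 F1P] := ovl_adh a c d0; have [F2 F2P] := ovl_adh b b d0.
pose F := F1 ++ F2.
have FF1 : {subset F1 <= F} by move=> g; rewrite mem_cat => ->.
have FF2 : {subset F2 <= F} by move=> g; rewrite mem_cat => ->; rewrite orbT.
have := MPsi_sub a c FF1; have := MPsi_sub b b FF2.
have : MPsi F a c + MPsi F b b <= MPsi F a b + MPsi F b c.
  rewrite -!MD//; apply: M_le => [||t]; [exact: xbD|exact: xbD|].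
  by rewrite /Psi/= maxxx /Num.max; do 3![case: ifPn; rewrite -?leNgt => ?]; lra.
have := ovl_ub F a b; have := ovl_ub F b c.
by move: F1P F2P; rewrite /d; lra.
Qed.

Let D a b := ovl a b - ovl z z.

Let ovlzz a : ovl a a = ovl z z.
Proof. by apply/eqP; rewrite eq_le !ovl_diag. Qed.

Let Dxx a : D a a = 0. Proof. by rewrite /D ovlzz subrr. Qed.
Let DC a b : D a b = D b a. Proof. by rewrite /D ovlC. Qed.
Let DD b a c : D a c <= D a b + D b c.
Proof. by have := ovl_tri b a c; rewrite ovlzz /D; lra. Qed.

Lemma S_eq_ovl a b : S_eq act a b -> ovl a b = ovl a a.
Proof.
move=> ab; have := @S_eq_pdist _ _ _ _ hX (PDist Dxx DC DD) _ _ a b ab.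
rewrite /= ovlzz /D => D0; apply/eqP; rewrite -subr_eq0; apply/eqP; apply: D0.
  by move=> g x y; rewrite /D ovl_act.
move=> x e e0; have := ovl_near x e0; apply: filterS => y.
by rewrite ovlzz; lra.
Qed.

(** Otherwise every [Phi F b] vanishes on [N], while the single element [g] contributes at [a] at
    least the function [p], which is supported in [N] and has positive mean. Adding it to a stage
    that almost attains [ovl b b] would make [ovl a b] exceed [ovl b b]. *)
Lemma ovl_witness a b (N : set X) t g : S_eq act a b -> open N -> N t ->
  u (act g a) = 1 -> v (act g t) = 1 ->
  exists h t', [/\ N t', 0 < u (act h b) & 0 < v (act h t')].
Proof.
move=> ab oN Nt ua vt; apply: contrapT => nex.
have [w [cw w01 wt wN]] := bump_exists R oN Nt.
pose p s := Num.min (v (act g s)) (w s).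
have p01 s : 0 <= p s <= 1.
  rewrite /p le_min ge_min; have /andP[-> ->] := v01 (act g s).
  by have /andP[-> _] := w01 s.
have cp : continuous p.
  move=> s; apply: continuous_min; last exact: cw.
  by apply: continuous_comp; [exact: cact|exact: cv].
have Mp : 0 < M p by apply: (@orbit_mean_gt0 p t) => //; rewrite /p vt wt minxx.
have [F Fb] := ovl_adh b b Mp.
have : MPsi F b b + M p <= MPsi (g :: F) a b.
  rewrite -MD//; last exact: xb01.
  apply: M_le => //; first by apply: xbD => //; exact: xb01.
  move=> s; rewrite /Psi maxxx.
  have [Ns|nNs] := pselect (N s); last first.
    have -> : p s = 0.
      by rewrite /p (wN _ nNs) min_r//; have /andP[] := v01 (act g s).
    rewrite addr0 le_max (Phi_sub b s (F := F)) ?orbT// => h.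
    by rewrite inE => ->; rewrite orbT.
  have -> : Phi F b s = 0.
    apply/eqP; rewrite eq_le (andP (Phi01 F b s)).1 andbT Phi_le lexx/=.
    apply/allP => h _; rewrite leNgt; apply/negP; rewrite lt_min => /andP[? ?].
    by apply: nex; exists h, s.
  rewrite add0r le_max /= ua le_max; apply/orP; left; apply/orP; left.
  rewrite le_min /p !ge_min lexx; have /andP[_ ->] := v01 (act g s); lra.
have := ovl_ub (g :: F) a b; rewrite (S_eq_ovl ab).
by move: Fb; rewrite !ovlzz; lra.
Qed.

End pseudometric.

(* That is, the set of points moved into [W] by some g with g N meeting [C] is a
   union of fibres of the maximal equicontinuous factor. *)
Lemma S_eq_meets a b (W N C : set X) g t : S_eq act a b ->
  open W -> open N -> open C -> W (act g a) -> N t -> C (act g t) ->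
  exists h t', [/\ N t', W (act h b) & C (act h t')].
Proof.
move=> ab oW oN oC Wga Nt Cgt.
have [u [cu u01 ua uW]] := bump_exists R oW Wga.
have [v [cv v01 vt vC]] := bump_exists R oC Cgt.
have [h [t' [Nt' u0 v0]]] := ovl_witness cu cv u01 v01 ab oN Nt ua vt.
exists h, t'; split=> //; apply: contrapT.
  by move=> /uW u0'; rewrite u0' ltxx in u0.
by move=> /vC v0'; rewrite v0' ltxx in v0.
Qed.

End saturation.

Lemma ball_eq (R : realType) (T : pseudoMetricType R) (x y : T) :
  hausdorff_space T -> (forall e : R, 0 < e -> ball x e y) -> x = y.
Proof.
move=> hT xy; apply: (close_eq hT); rewrite ball_close => e; exact: xy.
Qed.

Lemma ultra_lim (T : topologicalType) (I : Type) (U : set_system I)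
    (s : I -> T) :
  compact [set: T] -> UltraFilter U -> exists p : T, s @ U --> p.
Proof.
rewrite compact_ultra => cT UU.
have UI := ultra_fmap s UU; have FI := @ultra_proper _ _ UI.
have [|p [_ sp]] := cT _ UI; first exact: filterT.
by exists p.
Qed.

Section maximal_factor.
Variables (R : realType) (G : zmodType) (X H : pseudoMetricType R).
Variables (act : G -> X -> X) (actH : G -> H -> H) (pi : X -> H).
Hypothesis hX : Gsystem act.
Hypothesis hpi : max_equicontinuous_factor act actH pi.

(* A failure of equicontinuity lifts to ultralimits a, a' and b, b' in X of
   x n, x' n and of their translates with pi a = pi a' but pi b <> pi b';
   an equicontinuous quotient of X separating b and b' would identify a and
   a', and hence b and b'. *)
Lemma max_factor_equicontinuous : equicontinuous_system actH.
Proof.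
have [hH [pic [piT pie]] piS] := hpi.
have surj y : exists x, pi x = y.
  by have : [set: H] y by []; rewrite -piT => -[x _ <-]; exists x.
move=> e e0; apply: contrapT => ne.
have bad n : exists w : X * X * G, ball (pi w.1.1) n.+1%:R^-1 (pi w.1.2) /\
    ~ ball (pi (act w.2 w.1.1)) e (pi (act w.2 w.1.2)).
  apply: contrapT => nw; apply: ne; exists n.+1%:R^-1 => // y y' yy' g.
  have [x xy] := surj y; have [x' xy'] := surj y'.
  apply: contrapT => nb; apply: nw; exists (x, x', g) => /=.
  by rewrite !pie xy xy'.
have [w wP] := choice bad.
have [U [UU Uoo]] := @ultraFilterLemma _ (\oo : set_system nat) _.
have FU := @ultra_proper _ _ UU.
have UI A B : U A -> U B -> U (A `&` B) by exact: filterI.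
have UE A : U A -> exists n, A n by exact: filter_ex.
have cX := hX.1.2.
have [a xa] := ultra_lim (fun n => (w n).1.1) cX UU.
have [a' xa'] := ultra_lim (fun n => (w n).1.2) cX UU.
have [b xb] := ultra_lim (fun n => act (w n).2 (w n).1.1) cX UU.
have [b' xb'] := ultra_lim (fun n => act (w n).2 (w n).1.2) cX UU.
have lim_ball (Y : pseudoMetricType R) (f : X -> Y) s p : continuous f ->
    s @ U --> p -> forall d : R, 0 < d -> \forall n \near U, ball (f p) d (f (s n)).
  move=> cf sp d d0.
  have : f \o s @ U --> f p by apply: continuous_cvg => //; exact: cf.
  by move=> /cvg_ballP/(_ d d0).
have near_small d : 0 < d -> \forall n \near U, ball (pi (w n).1.1) d (pi (w n).1.2).
  move=> d0; apply: Uoo; near=> n.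
  apply: (@le_ball _ _ _ n.+1%:R^-1 d); last exact: (wP n).1.
  by apply/ltW; near: n; exact: near_infty_natSinv_lt (PosNum d0).
have aa' : S_eq act a a'.
  apply/piS; apply: ball_eq; first exact: hH.1.1.
  move=> d d0; have d20 : 0 < d / 2 by rewrite divr_gt0.
  have d40 : 0 < d / 2 / 2 by rewrite divr_gt0.
  have /UE[n [[n1 n2] n3]] := UI _ _ (UI _ _ (lim_ball _ _ _ _ pic xa _ d20)
    (lim_ball _ _ _ _ pic xa' _ d40)) (near_small _ d40).
  by apply: (ball_split n1); exact: ball_split n3 (ball_sym n2).
have nbb' : ~ S_eq act b b'.
  move=> /piS bb'.
  have e20 : 0 < e / 2 by rewrite divr_gt0.
  have /UE[n [n1 n2]] := UI _ _ (lim_ball _ _ _ _ pic xb _ e20)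
    (lim_ball _ _ _ _ pic xb' _ e20).
  by apply: (wP n).2; apply: ball_splitr n1 _; rewrite bb'.
apply: nbb' => Rel aRel; have [_ _ _ _ [Y [actY [f [hY [fc [_ fe]] eqY fR]]]]] := aRel.
apply/fR; apply: ball_eq; first exact: hY.1.1.
move=> d d0; have d20 : 0 < d / 2 by rewrite divr_gt0.
have d40 : 0 < d / 2 / 2 by rewrite divr_gt0.
have [del del0 delP] := eqY _ d40; have del20 : 0 < del / 2 by rewrite divr_gt0.
have faa' : f a = f a' by apply/fR; exact: aa'.
have /UE[n [[n1 n2] [n3 n4]]] := UI _ _
  (UI _ _ (lim_ball _ _ _ _ fc xa _ del20) (lim_ball _ _ _ _ fc xa' _ del20))
  (UI _ _ (lim_ball _ _ _ _ fc xb _ d20) (lim_ball _ _ _ _ fc xb' _ d40)).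
apply: (ball_split n3); apply: ball_split (ball_sym n4); rewrite !fe; apply: delP.
by apply: ball_splitr n1 _; rewrite faa'.
Unshelve. all: by end_near. Qed.

End maximal_factor.

(** * Moving several open sets into prescribed ones by a single group element *)

Section hitting.
Variables (R : realType) (G : countZmodType) (X H : pseudoMetricType R).
Variables (act : G -> X -> X) (actH : G -> H -> H) (pi : X -> H).
Hypotheses (hX : Gsystem act) (mX : minimal_system act).
Hypothesis hpi : max_equicontinuous_factor act actH pi.

Let aX : is_action act. Proof. exact: hX.2.1. Qed.
Let cact : forall g, continuous (act g). Proof. exact: hX.2.2. Qed.
Let pic : continuous pi. Proof. by have [_ [? _] _] := hpi. Qed.

(* The coordinates in [J] are moved one at a time from [W j] into the
   prescribed set [V j], along a fibre of [pi] (by [S_eq_meets]). *)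
Lemma joint_hitting (I : finType) (W V : I -> set X) (J : seq I) :
  (forall i, open (W i)) -> (forall i, open (V i)) ->
  (forall i, V i !=set0) ->
  (forall i, i \notin J -> V i `<=` W i) ->
  (forall i, i \in J -> V i `<=` pi @^-1` (pi @` W i)°) ->
  exists g, forall i, exists2 x, W i x & V i (act g x).
Proof.
move=> oW; elim: J V => [|j J IH] V oV V0 VW VJ.
  exists 0 => i; have [x Vx] := V0 i; exists x; last by rewrite act0.
  exact: (VW i isT).
pose Q := (pi @` V j)°.
have Q0 : Q !=set0.
  by have [hH fpi _] := hpi; exact: (factor_semi_open hX hH mX fpi).
have oQ : open Q by exact: open_interior.
have QW : Q `<=` pi @` W j.
  move=> y /interior_subset[x Vx <-].
  by apply: interior_subset; exact: VJ (mem_head _ _) _ Vx.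
(* In coordinate [j] the target is relaxed to the part of [W j] over [Q]: it lies in [W j], and each
   of its points shares its fibre with a point of [V j]. *)
pose V' i := if i == j then W j `&` pi @^-1` Q else V i.
have oV' i : open (V' i).
  rewrite /V'; case: eqP => _ //; apply: openI => //.
  by apply: open_comp => // x _; exact: pic.
have [||||g0 g0P] := IH V' => //.
- move=> i; rewrite /V'; case: eqP => _ //; have [y Qy] := Q0.
  by have [x Wx xy] := QW _ Qy; exists x; split=> //; rewrite /preimage/= xy.
- move=> i iJ; rewrite /V'; case: eqP => [-> x []//|/eqP ij].
  by apply: VW; rewrite inE negb_or ij.
- move=> i iJ; rewrite /V'; case: eqP => [->|_]; last first.
    by apply: VJ; rewrite inE iJ orbT.
  by move=> x [Wx Qx]; apply: filterS QW _; exact: open_nbhs_nbhs.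
have [wj Wwj] := g0P j; rewrite /V' eqxx => -[Wx Qx].
set x := act g0 wj in Wx Qx.
have [x' Vx' x'x] := interior_subset Qx.
(* By minimality, every coordinate can be represented by a translate of the single point [x]. *)
have hex i : exists h, V' i (act h x) /\ W i (act (- g0) (act h x)).
  have [w Ww Vw] := g0P i.
  have oVW : open (V' i `&` act (- g0) @^-1` W i).
    by apply: openI => //; exact: open_act_preimage.
  have [|h [Vh Wh]] := orbit_meets mX x oVW.
    by exists (act g0 w); split=> //=; rewrite actK.
  by exists h.
have [h hP] := choice hex.
(* A point [t] of [N] moved into [C] by some [g] serves all coordinates other than [j] at once.
   [S_eq_meets] keeps this available while [x] is exchanged for [x'], which lies in [V j]. *)
pose N := [set t | forall i, V' i (act (h i) t)].
pose C := [set t | forall i, W i (act (h i) t)].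
have oN : open N.
  by apply: (open_forall (f := fun i => act (h i) @^-1` V' i)) => i; apply: open_act_preimage.
have oC : open C.
  by apply: (open_forall (f := fun i => act (h i) @^-1` W i)) => i; apply: open_act_preimage.
have [m mm] := mean_exists R G.
have xx' : S_eq act x x' by have [_ _ <-] := hpi.
have [|||g [t' [Nt' Wt' Ct']]] := S_eq_meets mm hX mX x (a := x) (b := x')
    (g := - g0) (t := x) xx' (oW j) oN oC.
- by rewrite /x actK.
- by move=> i; have [] := hP i.
- by move=> i; rewrite actC//; have [] := hP i.
exists (- g) => i; have [->|ij] := eqVneq i j.
  by exists (act g x') => //; rewrite actK.
exists (act g (act (h i) t')); first by rewrite actC//; exact: Ct'.
by rewrite actK//; have := Nt' i; rewrite /V' (negbTE ij).
Qed.

End hitting.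

(** * Invariant measures on the equicontinuous factor *)

Section finite_measure.
Variables (R : realType) (d : measure_display) (T : measurableType d).
Variable nu : probability T R.
Implicit Types A B D : set T.

Definition pr A : R := fine (nu A).

Lemma prE A : measurable A -> nu A = (pr A)%:E.
Proof. by move=> mA; rewrite /pr fineK// fin_num_measure. Qed.

Lemma pr_ge0 A : 0 <= pr A.
Proof. exact: fine_ge0. Qed.

Lemma pr_le A B : measurable A -> measurable B -> A `<=` B -> pr A <= pr B.
Proof.
by move=> mA mB AB; rewrite -lee_fin -!prE//; apply: le_measure; rewrite ?inE.
Qed.

Lemma prU_le A B : measurable A -> measurable B -> pr (A `|` B) <= pr A + pr B.
Proof.
move=> mA mB; rewrite -lee_fin EFinD -!prE//; first exact: measureU2.
exact: measurableU.
Qed.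

Lemma prD A B : measurable A -> measurable B -> B `<=` A ->
  pr (A `\` B) = pr A - pr B.
Proof.
move=> mA mB BA; apply: EFin_inj; rewrite EFinB -!prE//; last exact: measurableD.
by rewrite measureD ?setIidr// ltey_eq fin_num_measure.
Qed.

Lemma prT : pr setT = 1.
Proof. by rewrite /pr probability_setT. Qed.

Lemma pr_bigU_le (I : Type) (s : seq I) (A : I -> set T) :
  (forall i, measurable (A i)) ->
  pr (\big[setU/set0]_(i <- s) A i) <= \sum_(i <- s) pr (A i).
Proof.
move=> mA; elim: s => [|i s IH]; first by rewrite !big_nil /pr measure0.
rewrite !big_cons; apply: le_trans (prU_le _ _) _ => //; last by rewrite lerD2l.
exact: bigsetU_measurable.
Qed.

(** Used to pass from pointwise bounds on the number of sets containing y to bounds on sums of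
    measures. *)
Lemma sum_pr_integral D (I : Type) (s : seq I) (S : I -> set T) :
  measurable D -> (forall i, measurable (S i)) ->
  (\sum_(i <- s) pr (S i `&` D))%:E =
  (\int[nu]_(y in D) (\sum_(i <- s) \1_(S i) y)%:E)%E.
Proof.
move=> mD mS; under [RHS]eq_integral do rewrite -sumEFin.
rewrite ge0_integral_sum//; last first.
  by move=> i; apply/measurable_EFinP; exact: measurable_indic.
rewrite -sumEFin; apply: eq_bigr => i _.
by rewrite integral_indic//; apply/esym/prE; exact: measurableI.
Qed.

Let msum (I : Type) (s : seq I) (S : I -> set T) D :
  (forall i, measurable (S i)) ->
  measurable_fun D (fun y => (\sum_(i <- s) \1_(S i) y)%:E : \bar R).
Proof.
move=> mS; apply/measurable_EFinP.
by apply: measurable_sum => i; exact: measurable_indic.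
Qed.

Let sum0 (I : Type) (s : seq I) (S : I -> set T) y :
  (0 <= (\sum_(i <- s) \1_(S i) y)%:E :> \bar R)%E.
Proof. by rewrite lee_fin sumr_ge0// => i _; rewrite indicE. Qed.

Lemma sum_pr_ge D (I : Type) (s : seq I) (S : I -> set T) (r : R) :
  measurable D -> (forall i, measurable (S i)) -> 0 <= r ->
  (forall y, D y -> r <= \sum_(i <- s) \1_(S i) y) ->
  r * pr D <= \sum_(i <- s) pr (S i `&` D).
Proof.
move=> mD mS r0 rS; rewrite -lee_fin sum_pr_integral// EFinM.
rewrite (_ : (pr D)%:E = nu D) -?(integral_cst nu mD); last exact/esym/prE.
apply: ge0_le_integral => //=.
exact: msum.
Qed.

Lemma sum_pr_le (I : Type) (s : seq I) (S : I -> set T) (r : R) :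
  (forall i, measurable (S i)) -> 
  (forall y, \sum_(i <- s) \1_(S i) y <= r) ->
  \sum_(i <- s) pr (S i) <= r.
Proof.
move=> mS rS; have r0 : 0 <= r.
  by apply: le_trans (rS point); rewrite sumr_ge0// => i _; rewrite indicE.
rewrite -[leRHS]mulr1 -prT.
under eq_bigr do rewrite -[S _]setIT.
rewrite -lee_fin sum_pr_integral// EFinM.
rewrite (_ : (pr _)%:E = nu setT) -?(integral_cst nu measurableT); last exact/esym/prE.
apply: ge0_le_integral => //=.
  exact: msum.
by move=> y _; rewrite lee_fin.
Qed.

End finite_measure.

Section borel.
Variables (R : realType) (H : pseudoPMetricType R) (nu : probability (Borel H) R).
Implicit Types (A E : set H).

Lemma borel_open A : open A -> measurable (A : set (Borel H)).
Proof. by move=> oA; exact: sub_sigma_algebra. Qed.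

Lemma borel_closed A : closed A -> measurable (A : set (Borel H)).
Proof.
move=> cA; rewrite -[A]setCK; apply: measurableC; apply: borel_open.
exact: closed_openC.
Qed.

Lemma borel_preimage (f : H -> H) (A : set (Borel H)) : continuous f ->
  measurable A -> measurable (f @^-1` A : set (Borel H)).
Proof.
move=> cf mA; rewrite -[X in measurable X]setTI.
have mf : measurable_fun [set: Borel H] (f : Borel H -> Borel H).
  apply: (@measurability _ _ (Borel H) (Borel H) setT f (@open H)) => //.
  move=> _ [U oU <-]; rewrite setTI; apply: borel_open.
  by apply: open_comp => // x _; exact: cf.
exact: mf.
Qed.

(** The open neighbourhood of radius [e]; interiors are taken since an abstract [ball] need not be
    open. *)
Definition thick E (e : R) : set H := \bigcup_(y in E) (ball y e)°.

Lemma open_thick E e : open (thick E e).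
Proof. by apply: bigcup_open => y _; exact: open_interior. Qed.

Lemma thick_sub E e1 e2 : e1 <= e2 -> thick E e1 `<=` thick E e2.
Proof.
move=> e12 y [z Ez yz]; exists z => //; apply: interiorS yz => t.
exact: le_ball.
Qed.

Lemma ball_interior (T : pseudoMetricType R) (x y : T) (e : R) : 0 < e ->
  ball x (e / 2) y -> (ball x e)° y.
Proof.
move=> e0 xy; apply/nbhs_ballP; exists (e / 2); first by rewrite /= divr_gt0.
by move=> z yz; exact: ball_split xy yz.
Qed.

Lemma bigcap_thick E : closed E -> \bigcap_n thick E n.+1%:R^-1 = E.
Proof.
move=> cE; apply/seteqP; split=> [y yT|y Ey n _]; last first.
  exists y => //; apply: ball_interior; first by rewrite invr_gt0.
  by apply: ballxx; rewrite divr_gt0// invr_gt0.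
apply: cE => U /nbhs_ballP[e /= e0 eU].
have [n _ nP] := near_infty_natSinv_lt (PosNum e0).
have [z Ez yz] := yT n I; exists z; split=> //; apply: eU; apply: ball_sym.
apply: (@le_ball _ _ z n.+1%:R^-1); last exact: interior_subset.
by apply/ltW/nP => /=.
Qed.

(** Continuity of the measure from above, as the neighbourhoods of radius 1/(n+1) decrease to the
    closed set [E]. *)
Lemma pr_thick E D (c : R) : closed E -> measurable (D : set (Borel H)) -> 0 < c ->
  exists2 e : R, 0 < e & pr nu (thick E e `&` D) < pr nu (E `&` D) + c.
Proof.
move=> cE mD c0.
have mth e : measurable (thick E e `&` D : set (Borel H)).
  by apply: measurableI => //; apply: borel_open; exact: open_thick.
have mED : measurable (E `&` D : set (Borel H)).
  by apply: measurableI => //; exact: borel_closed.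
have ED : \bigcap_n (thick E n.+1%:R^-1 `&` D) = E `&` D.
  apply/seteqP; split=> [y yT|y [Ey Dy] n _].
    split; last by have [] := yT 0%N I.
    by rewrite -(bigcap_thick cE) => n _; have [] := yT n I.
  by split=> //; move: Ey; rewrite -{1}(bigcap_thick cE); apply.
have : nu (thick E n.+1%:R^-1 `&` D) @[n --> \oo] --> nu (E `&` D).
  rewrite -ED; apply: nonincreasing_cvg_mu => //.
  - by rewrite ltey_eq fin_num_measure.
  - by rewrite ED.
  - apply/nonincreasing_seqP => n; apply/subsetPset.
    apply: setSI; apply: thick_sub.
    by rewrite lef_pV2 ?posrE// ler_nat.
rewrite prE// => /fine_cvgP[_ /cvgrPdist_lt/(_ c c0)[n _ /(_ n (leqnn n))/= nP]].
exists n.+1%:R^-1; first by rewrite invr_gt0.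
by move: nP; rewrite -/(pr nu _) ltr_norml => /andP[]; lra.
Qed.

End borel.

(** * Small translations of the equicontinuous factor *)

Section translations.
Variables (R : realType) (G : zmodType) (H : pseudoPMetricType R).
Variables (actH : G -> H -> H) (nu : probability (Borel H) R).
Hypotheses (hH : Gsystem actH) (mH : minimal_system actH).
Hypothesis eqH : equicontinuous_system actH.
Hypothesis nuI : forall g (A : set (Borel H)), measurable A ->
  nu (actH g @^-1` A) = nu A.

Let aH : is_action actH. Proof. exact: hH.2.1. Qed.
Let cH : forall g, continuous (actH g). Proof. exact: hH.2.2. Qed.

Lemma pr_translate g (A : set (Borel H)) : measurable A ->
  pr nu (actH g @^-1` A) = pr nu A.
Proof. by move=> mA; rewrite /pr nuI. Qed.

(** Some [h] moves y close to z and, by commutativity, [actH g y] close to [actH g z];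
    equicontinuity keeps the two images under [h] close to each other. *)
Lemma small_displacement (e : R) : 0 < e -> exists2 eta : R, 0 < eta &
  forall y g, ball y eta (actH g y) -> forall z, ball z e (actH g z).
Proof.
move=> e0; pose d := e / 4; have d0 : 0 < d by rewrite divr_gt0.
have [eta eta0 etaP] := eqH d0; exists eta => // y g yg z.
pose U := (ball z d)° `&` actH g @^-1` (ball (actH g z) d)°.
have oU : open U.
  apply: openI; first exact: open_interior.
  by apply: open_act_preimage => //; exact: open_interior.
have Uz : U z by split; apply: ball_interior => //; apply: ballxx; rewrite divr_gt0.
have [h [/interior_subset zh /interior_subset gzh]] :=
  orbit_meets mH y oU (ex_intro _ z Uz).
have hg := etaP _ _ yg h; rewrite actC// in hg.
have := ball_triangle (ball_triangle zh hg) (ball_sym gzh).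
by apply: le_ball; rewrite /d; lra.
Qed.

Lemma small_translates (I : finType) (E : set H) : closed E -> 0 < pr nu E ->
  exists2 eta : R, 0 < eta & forall gam : I -> G,
    (forall i y, ball y eta (actH (gam i) y)) ->
    0 < pr nu [set y | forall i, E (actH (gam i) y)].
Proof.
move=> cE E0; pose c := pr nu E / (#|I|.+1)%:R.
have c0 : 0 < c by rewrite divr_gt0.
have [e e0] := @pr_thick _ _ nu E setT c cE measurableT c0.
rewrite !setIT => Te; exists (e / 2); first by rewrite divr_gt0.
move=> gam gamP; rewrite ltNge; apply/negP => A0.
pose A i := actH (gam i) @^-1` E; pose T := thick E e.
have cA i : closed (A i) by apply: closed_comp => // y _; exact: cH.
have mA i : measurable (A i : set (Borel H)) by exact: borel_closed.
have mT : measurable (T : set (Borel H)) by apply: borel_open; exact: open_thick.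
have mE : measurable (E : set (Borel H)) by exact: borel_closed.
have AT i : A i `<=` T.
  move=> y Ay; exists (actH (gam i) y) => //; apply: ball_interior => //.
  exact/ball_sym/gamP.
have mTA i : measurable (T `\` A i : set (Borel H)) by exact: measurableD.
have mcap : measurable ([set y | forall i, E (actH (gam i) y)] : set (Borel H)).
  by apply: borel_closed; exact: (closed_forall cA).
have ET : pr nu E <= pr nu T.
  apply: pr_le => // y Ey; exists y => //; apply: ball_interior => //.
  by apply: ballxx; rewrite divr_gt0.
have : pr nu T <= \sum_(i <- enum I) pr nu (T `\` A i).
  rewrite -[leRHS]add0r; apply: le_trans _ (lerD A0 (pr_bigU_le nu (enum I) mTA)).
  apply: le_trans _ (prU_le nu mcap (bigsetU_measurable _ _)) => //.
  apply: pr_le => //.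
    by apply: measurableU => //; exact: bigsetU_measurable.
  move=> y Ty; have [yA|yA] := pselect (forall i, E (actH (gam i) y)); first by left.
  right; apply: contrapT => nU; apply: yA => i; apply: contrapT => nE; apply: nU.
  by rewrite -bigcup_seq; exists i => //=; rewrite mem_enum.
have TA i : pr nu (T `\` A i) <= c.
  by rewrite prD// [pr nu (A i)]pr_translate//; move: Te; rewrite -/T; lra.
have : \sum_(i <- enum I) pr nu (T `\` A i) <= c * #|I|%:R.
  apply: le_trans (ler_sum _ (fun i _ => TA i)) _.
  by rewrite big_const_seq count_predT iter_addr addr0 mulr_natr cardE.
have : c * #|I|%:R < pr nu E.
  by rewrite /c mulrAC ltr_pdivrMr// ltr_pM2l// ltr_nat.
lra.
Qed.

End translations.

(** * Inductive construction of the independent sequence *)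

Section independence.
Variables (R : realType) (G : countZmodType) (X : pseudoMetricType R).
Variables (H : pseudoPMetricType R).
Variables (act : G -> X -> X) (actH : G -> H -> H) (pi : X -> H).
Variable nu : probability (Borel H) R.
Hypotheses (hX : Gsystem act) (mX : minimal_system act).
Hypothesis hpi : max_equicontinuous_factor act actH pi.
Hypothesis nuI : forall g (A : set (Borel H)), measurable A ->
  nu (actH g @^-1` A) = nu A.
Variables (K : finType) (U : K -> set X) (E : set H).
Hypotheses (oU : forall j, open (U j)) (cE : closed E) (E0 : 0 < pr nu E).
Hypothesis EU : forall j, E `<=` pi @` U j.

Let hH : Gsystem actH. Proof. by have [] := hpi. Qed.
Let fpi : factor_map act actH pi. Proof. by have [] := hpi. Qed.
Let mH : minimal_system actH. Proof. exact: factor_minimal mX fpi. Qed.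
Let eqH : equicontinuous_system actH.
Proof. exact: max_factor_equicontinuous hX hpi. Qed.
Let aX : is_action act. Proof. exact: hX.2.1. Qed.
Let cact : forall g, continuous (act g). Proof. exact: hX.2.2. Qed.
Let aH : is_action actH. Proof. exact: hH.2.1. Qed.
Let cH : forall g, continuous (actH g). Proof. exact: hH.2.2. Qed.
Let pic : continuous pi. Proof. by have [? _] := fpi. Qed.
Let pie g x : pi (act g x) = actH g (pi x). Proof. by have [_ [_ ->]] := fpi. Qed.

(* Every word of length [size l] is realised by a nonempty open cell [W i];
   the images of the cells contain small translates [gam i] of a common point,
   small enough for [E] and its translates to meet in positive measure. *)
Definition extendable (l : seq G) := exists (I : finType) (W : I -> set X)
    (gam : I -> G) (y0 : H),
  [/\ forall i, open (W i),
      forall i, (pi @` W i)° (actH (gam i) y0),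
      0 < pr nu [set y | forall i, E (actH (gam i) y)] &
      forall w : nat -> K, exists i, forall n, (n < size l)%N ->
        W i `<=` act (nth 0 l n) @^-1` U (w n)].

Lemma extendable_nil : extendable [::].
Proof.
exists unit, (fun=> setT), (fun=> 0), point; split=> //.
- by move=> _; exact: openT.
- move=> _; have [_ [piT _]] := fpi.
  have : nbhs (actH 0 (point : H)) [set: H] by exact: filterT.
  by rewrite -piT.
- rewrite (_ : mkset _ = E) //; apply/seteqP; split=> y.
    by move=> /(_ tt); rewrite act0.
  by move=> Ey _ /=; rewrite act0.
Qed.

(** A point y of [E'] has all its translates [actH (gam i) y] in [E], so every [U j] meets the
    fibres over them. After a translation by [g] brings the images of the cells around these points,
    [joint_hitting] splits each cell according to the next letter. *)
Lemma extendable_rcons l : extendable l -> exists g, extendable (rcons l g).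
Proof.
move=> [I [W [gam [y0 [oW Wy0 E'0 Wl]]]]].
set E' := [set y | _] in E'0.
have cE' : closed E'.
  apply: (closed_forall (f := fun i => actH (gam i) @^-1` E)) => i.
  by apply: closed_comp => // y _; exact: cH.
have [eta eta0 etaP] := small_translates hH nuI (I * K)%type cE' E'0.
have [del del0 delP] := small_displacement hH mH eqH eta0.
have [y Ey] : E' !=set0.
  apply/set0P/eqP => E'E; move: E'0; rewrite E'E /pr measure0 /=.
  by rewrite ltxx.
have [g gP] : exists g, forall i, (pi @` W i)° (actH (gam i) (actH g y)).
  have oO : open [set z | forall i, (pi @` W i)° (actH (gam i) z)].
    apply: (open_forall (f := fun i => actH (gam i) @^-1` (pi @` W i)°)) => i.
    by apply: open_act_preimage => //; exact: open_interior.
  have [|g Og] := orbit_meets mH y oO; first by exists y0.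
  by exists g.
pose W' i := act g @^-1` W i.
have W'y i : (pi @` W' i)° (actH (gam i) y).
  have : nbhs (actH (gam i) y) (actH g @^-1` (pi @` W i)°).
    apply: cH; rewrite actC//; apply: open_nbhs_nbhs; split=> //.
    exact: open_interior.
  apply: filterS => z /interior_subset[x Wx xz].
  exists (act (- g) x); first by rewrite /W'/= actNK.
  by rewrite pie xz actK.
have oW' i : open (W' i) by exact: open_act_preimage.
(* The first factor permits the use of [joint_hitting]; the second, staying over points close to
   [actH (gam i) y], keeps the new translates close to the old ones. *)
pose Q i := (pi @` W' i)° `&` actH (- gam i) @^-1` (ball y del)°.
pose V (p : I * K) := U p.2 `&` pi @^-1` Q p.1.
have oV p : open (V p).
  apply: openI => //; apply: open_comp => [x _|]; first exact: pic.
  apply: openI; first exact: open_interior.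
  by apply: open_act_preimage => //; exact: open_interior.
have V0 p : V p !=set0.
  have [u Uu uy] := EU p.2 (Ey p.1).
  exists u; split=> //; rewrite /preimage/= uy; split; first exact: W'y.
  by rewrite /preimage/= actK//; apply: ball_interior => //; apply: ballxx; rewrite divr_gt0.
have [||h0 h0P] := joint_hitting hX mX hpi (W := fun p : I * K => W' p.1)
    (V := V) (J := enum {: I * K}) (fun p => oW' p.1) oV V0.
- by move=> p; rewrite mem_enum.
- by move=> p _ x [_ []].
(* Since [W' i] is the preimage of [W i] under [g], the shift from [W i] into [V p] is by h0 - g. *)
pose h := h0 - g; pose W2 (p : I * K) := W p.1 `&` act h @^-1` V p.
have oW2 p : open (W2 p) by apply: openI => //; exact: open_act_preimage.
have W20 p : W2 p !=set0.
  have [x Wx Vx] := h0P p; exists (act g x); split=> //.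
  by rewrite /preimage/= -actD// /h subrK.
pose y1 := actH (- h) y.
have gamex p : exists k, (pi @` W2 p)° (actH k y1).
  apply: (orbit_meets mH); first exact: open_interior.
  exact: (factor_semi_open hX hH mX fpi (oW2 p) (W20 p)).
have [gam2 gam2P] := choice gamex.
(* Acting by [h] on the point [actH (gam2 p) y1] gives [actH (gam2 p) y], which lies over [Q]; so
   the difference moves y by less than [del], and hence every point by less than [eta]. *)
have small p z : ball z eta (actH (gam2 p - gam p.1) z).
  apply: (delP y); have [x [Wx [_ [_ yx]]] xy] := interior_subset (gam2P p).
  move: yx; rewrite /preimage/= pie xy => /interior_subset.
  by rewrite /y1 (actC aH _ (- h)) actNK// -actD// addrC.
exists h, (I * K)%type, W2, gam2, y1; split=> //.
(* If gam2 - gam moves z into [E'], then applying gam as well puts [actH (gam2 p) z] in [E]. *)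
- apply: lt_le_trans (etaP _ small) _.
  have cP (F : set H) (k : I * K -> G) : closed F ->
      measurable ([set y | forall p, F (actH (k p) y)] : set (Borel H)).
    move=> cF; apply: borel_closed.
    apply: (closed_forall (f := fun p => actH (k p) @^-1` F)) => p.
    by apply: closed_comp => // z _; exact: cH.
  apply: pr_le; [exact: cP|exact: cP|] => z zE p.
  by have := zE p p.1; rewrite -actD// addrC subrK.
- move=> w; have [i iP] := Wl w; exists (i, w (size l)) => n.
  rewrite size_rcons ltnS leq_eqVlt nth_rcons => /orP[/eqP->|nl] x [Wx [Ux _]].
    by rewrite ltnn eqxx.
  by rewrite nl; exact: iP.
Qed.

Lemma independent_sequence : exists A : nat -> G, forall n (w : nat -> K),
  exists x, forall i, (i < n)%N -> U (w i) (act (A i) x).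
Proof.
pose S := {l : seq G | extendable l}.
have step (l : S) : {g : G | extendable (rcons (sval l) g)}.
  by apply: cid; apply: extendable_rcons; exact: svalP l.
pose next (l : S) : S := exist _ (rcons (sval l) (sval (step l))) (svalP (step l)).
pose s n := iter n next (exist _ [::] extendable_nil).
pose A n := sval (step (s n)).
have sE n : sval (s n) = mkseq A n.
  by elim: n => // n IH; rewrite mkseqS -IH.
exists A => n w.
have [I [W [gam [y0 [oW Wy0 _ Wl]]]]] := svalP (s n).
have [i iP] := Wl w; have [x Wx _] := interior_subset (Wy0 i).
exists x => m mn; move: iP; rewrite sE size_mkseq => /(_ m mn x Wx).
by rewrite /preimage/= nth_mkseq.
Qed.

End independence.

(** * Ergodicity of the invariant measure, by uniform averages *)

Section ergodicity.
Variables (R : realType) (G : countZmodType) (H : pseudoPMetricType R).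
Variables (actH : G -> H -> H) (nu : probability (Borel H) R).
Hypotheses (hH : Gsystem actH) (mH : minimal_system actH).
Hypothesis eqH : equicontinuous_system actH.
Hypothesis nuI : forall g (A : set (Borel H)), measurable A ->
  nu (actH g @^-1` A) = nu A.

Let aH : is_action actH. Proof. exact: hH.2.1. Qed.
Let cH : forall g, continuous (actH g). Proof. exact: hH.2.2. Qed.

Let le_indic (A B : set H) z z' : (A z -> B z') -> \1_A z <= \1_B z' :> R.
Proof.
move=> AB; rewrite !indicE ler_nat.
by case: (boolP (z \in A)) => // /set_mem/AB/mem_set->.
Qed.

Let indic_fb (A : set H) z : fbounded (fun g => \1_A (actH g z) : R).
Proof. by exists 1 => g; rewrite indicE ger0_norm// lern1 leq_b1. Qed.

(* Stands in for unique ergodicity. *)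
Lemma equidistribution (E : set H) (del eps : R) : 0 < del -> 0 < eps ->
  exists2 s : seq G, (0 < size s)%N & forall y y',
    (* The bound is uniform in both points, so it may later be integrated in each separately. *)
    \sum_(h <- s) \1_E (actH h y) <=
    \sum_(h <- s) \1_(thick E del) (actH h y') + eps * (size s)%:R.
Proof.
move=> del0 eps0; pose d := del / 6; have d0 : 0 < d by rewrite divr_gt0.
have [m mm] := mean_exists R G.
have [eta eta0 etaP] := eqH d0.
pose B (r : R) := [set z | exists2 e, E e & ball e r z].
have [|y|t tP] := @compact_finite_cover H H (fun y => (ball y eta)°) hH.1.2.
- by move=> y; exact: open_interior.
- by exists y; apply: ball_interior => //; apply: ballxx; rewrite divr_gt0.
have {}tP y : exists j : 'I_(size t), ball (nth y t j) eta y.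
  have [z zt /interior_subset zy] := tP y.
  by have := zt; rewrite -index_mem => zi; exists (Ordinal zi); rewrite /= nth_index.
(* A finite net leaves finitely many functions to average, so one list [s] suits all points. The
   radii d, 2d and finally 3d = del / 2 absorb the passages from y to [yj], from a translate of [yj]
   to [yl], and from [yl] to y'. *)
pose f (p : 'I_(size t) * bool) (g : G) : R :=
  \1_(B (if p.2 then d else 2 * d)) (actH g (nth point t p.1)).
have fb p : fbounded (f p) by exact: indic_fb.
have [s s0 sP] := mean_approx mm fb (divr_gt0 eps0 (ltr0Sn R 1)).
exists s => // y y'.
have [j] := tP y; rewrite (set_nth_default point)// => jy.
have [l] := tP y'; rewrite (set_nth_default point)// => ly.
set yj := nth _ _ _ in jy; set yl := nth _ _ _ in ly.
have size0 : 0 < (size s)%:R :> R by rewrite ltr0n.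
have avgE f' : \sum_(h <- s) f' h = avg s f' * (size s)%:R :> R.
  by rewrite /avg divfK// gt_eqF.
have [k kyl] : exists k, (ball yl eta)° (actH k yj).
  apply: (orbit_meets mH); first exact: open_interior.
  by exists yl; apply: ball_interior => //; apply: ballxx; rewrite divr_gt0.
have mf : m (f (j, true)) <= m (f (l, false)).
  rewrite -(mean_shift mm k (fb _)); apply: (mean_le mm) => //.
    by case: (fb (j, true)) => C CP; exists C => h; exact: CP.
  move=> g; apply: le_indic => -[e Ee /= eg]; exists e => //.
  rewrite mulrDl mul1r; apply: ball_triangle eg _.
  by rewrite (addrC k) actD//; apply: ball_sym; apply: etaP; exact: interior_subset.
have s1 : \sum_(h <- s) \1_E (actH h y) <= \sum_(h <- s) f (j, true) h.
  apply: ler_sum => h _; apply: le_indic => Eh; exists (actH h y) => //=.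
  by apply: ball_sym; exact: etaP.
have s2 : \sum_(h <- s) f (l, false) h <=
    \sum_(h <- s) \1_(thick E del) (actH h y').
  apply: ler_sum => h _; apply: le_indic => -[e Ee /= eh]; exists e => //.
  apply: ball_interior => //; rewrite (_ : del / 2 = 2 * d + d); last by rewrite /d; lra.
  by apply: ball_triangle eh _; exact: etaP.
apply: (le_trans s1); apply: le_trans _ (lerD s2 (lexx _)).
rewrite !avgE -mulrDl ler_wpM2r ?ltW//.
have := sP (j, true); have := sP (l, false).
rewrite !ltr_norml => /andP[? ?] /andP[? ?]; lra.
Qed.

(** Integrating [equidistribution] over y shows that every orbit visits [T] with frequency at least
    [pr nu E - c]; integrating this over the invariant complement [D] bounds [pr nu (T]&[D)] below
    by (pr E - c) pr D >= 2c, whereas it is less than c, because [E] misses [D]. *)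
Lemma ergodic (F : set (Borel H)) (E : set H) : measurable F ->
  (forall g, actH g @^-1` F = F) -> closed E -> E `<=` F -> 0 < pr nu E ->
  pr nu F = 1.
Proof.
move=> mF FI cE EF E0; pose D := ~` F.
have mD : measurable D by exact: measurableC.
have FE g y : F (actH g y) = F y by rewrite -[in RHS](FI g).
have DI g : actH g @^-1` D = D.
  by apply/seteqP; split=> y; rewrite /D /preimage /setC /= FE.
have mE : measurable (E : set (Borel H)) by exact: borel_closed.
have mpre g (A : set (Borel H)) : measurable A ->
  measurable (actH g @^-1` A : set (Borel H)) by exact: borel_preimage.
have FD : pr nu F = 1 - pr nu D.
  rewrite -(prT nu) -prD//; congr (pr nu _).
  by rewrite /D setDE setTI setCK.
suff D0 : pr nu D <= 0.
  by apply/eqP; rewrite FD eq_sym -subr_eq0 opprB addrC subrK eq_le D0 pr_ge0.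
rewrite leNgt; apply/negP => D0.
pose c := pr nu E * pr nu D / 3.
have c0 : 0 < c by rewrite /c divr_gt0// mulr_gt0.
have D1 : pr nu D <= 1 by rewrite -(prT nu) pr_le.
have cE1 : c <= pr nu E.
  rewrite /c -mulrA ler_piMr ?pr_ge0//.
  by move: D1; rewrite ler_pdivrMr; lra.
have [del del0] := pr_thick nu cE mD c0.
have -> : pr nu (E `&` D) = 0.
  rewrite (_ : _ `&` _ = set0) ?/pr ?measure0//.
  by apply/seteqP; split=> // y [/EF].
rewrite add0r => TD; set T := thick E del in TD.
have mT : measurable (T : set (Borel H)) by apply: borel_open; exact: open_thick.
have [s s0 sP] := equidistribution E del0 c0; rewrite -/T in sP.
have size0 : 0 < (size s)%:R :> R by rewrite ltr0n.
have sumc (r : R) : \sum_(h <- s) r = r * (size s)%:R.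
  by rewrite big_const_seq count_predT iter_addr addr0 mulr_natr.
have h1 y' : (pr nu E - c) * (size s)%:R <= \sum_(h <- s) \1_T (actH h y').
  rewrite mulrBl lerBlDr -sumc.
  have -> : \sum_(h <- s) pr nu E = \sum_(h <- s) pr nu (actH h @^-1` E).
    by apply: eq_bigr => h _; rewrite pr_translate.
  by apply: sum_pr_le => [h|y]; [exact: mpre|exact: sP].
have := @sum_pr_ge _ _ _ nu D G s (fun h => actH h @^-1` T)
  ((pr nu E - c) * (size s)%:R) mD (fun h => mpre h _ mT) _ (fun y _ => h1 y).
rewrite mulr_ge0 ?subr_ge0// => /(_ isT).
have -> : \sum_(h <- s) pr nu (actH h @^-1` T `&` D) = pr nu (T `&` D) * (size s)%:R.
  rewrite -sumc; apply: eq_bigr => h _.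
  by rewrite -{1}(DI h) -preimage_setI pr_translate//; exact: measurableI.
rewrite mulrAC ler_pM2r// mulrBl.
have cD : c * pr nu D <= c by rewrite ler_piMr// ltW.
have : pr nu E * pr nu D = 3 * c by rewrite /c; lra.
by move: TD cD; lra.
Qed.

End ergodicity.

(** * Independence and sequence entropy *)

Section entropy.
Variables (R : realType) (G : zmodType) (X : topologicalType).
Variables (act : G -> X -> X) (k : nat) (U : 'I_k.+1 -> set X) (A : nat -> G).
Hypothesis disjU : forall i j x, closure (U i) x -> closure (U j) x -> i = j.
Hypothesis indA : forall n (w : nat -> 'I_k.+1),
  exists x, forall i, (i < n)%N -> U (w i) (act (A i) x).

(** These sets form an open cover in which a point of [U i] belongs to [avoid i] only. *)
Let avoid j := ~` \bigcup_(i in [set i | i != j]) closure (U i).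

Let avoidU i j x : U i x -> avoid j x -> i = j.
Proof.
move=> Ux jx; apply/eqP; apply: contrapT => /negP ij; apply: jx.
by exists i => //; exact: subset_closure.
Qed.

Let avoid_cover x : exists j, avoid j x.
Proof.
have [[i Ui]|nU] := pselect (exists i, closure (U i) x); last first.
  by exists ord0 => -[i _ Ui]; apply: nU; exists i.
by exists i => -[j /= ji Uj]; rewrite (disjU Uj Ui) eqxx in ji.
Qed.

Let cover := range avoid.

Let cover_finite_open : finite_open_cover cover.
Proof.
split.
- by apply: finite_image; exact: finite_finset.
- move=> _ [j _ <-]; apply: closed_openC.
  by apply: closed_bigcup => [|i _]; [exact: finite_finset|exact: closed_closure].
- apply/seteqP; split=> // x _; have [j jx] := avoid_cover x.
  by exists (avoid j) => //; exists j.
Qed.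

Let word n (v : {ffun 'I_n -> 'I_k.+1}) (i : nat) : 'I_k.+1 :=
  if insub i is Some i' then v i' else ord0.

Let wordE n v (i : 'I_n) : word v i = v i.
Proof. by rewrite /word valK. Qed.

(** Points realising different words lie in different members of the join, and all words of length n
    are realised. *)
Let size_join_cover n (s : seq (set X)) :
  (forall i, (i < size s)%N -> join_cover act A n cover (nth set0 s i)) ->
  (forall x, exists2 i, (i < size s)%N & nth set0 s i x) ->
  (k.+1 ^ n <= size s)%N.
Proof.
move=> sJ sX.
have [x xP] := choice (fun v : {ffun 'I_n -> 'I_k.+1} => indA n (word v)).
have ix v : exists i : 'I_(size s), nth set0 s i (x v).
  by have [i is_ ix] := sX (x v); exists (Ordinal is_).
have [ind indP] := choice ix.
have inj_ind : injective ind.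
  move=> v v' vv'; apply/ffunP => i.
  have [f fC fE] := sJ (ind v) (ltn_ord _).
  have [j _ jE] := fC i.
  have := indP v; have := indP v'; rewrite -vv' -fE => /(_ i (ltn_ord i)) v'j.
  move=> /(_ i (ltn_ord i)) vj; rewrite /preimage/= -jE in vj v'j.
  rewrite -(wordE v) -(wordE v') (avoidU (xP v i (ltn_ord i)) vj).
  by rewrite (avoidU (xP v' i (ltn_ord i)) v'j).
by have := leq_card ind inj_ind; rewrite card_ffun !card_ord.
Qed.

(** Ensures that [Ncover] is finite, so that [fine] returns its true value and not the default 0. *)
Let join_cover_exists n : exists s : seq (set X),
  (forall i, (i < size s)%N -> join_cover act A n cover (nth set0 s i)) /\
  (forall x, exists2 i, (i < size s)%N & nth set0 s i x).
Proof.
pose cell (v : {ffun 'I_n -> 'I_k.+1}) :=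
  \bigcap_(i in `I_n) (act (A i) @^-1` avoid (word v i)).
pose e := enum {ffun 'I_n -> 'I_k.+1}.
exists [seq cell v | v <- e]; split.
  move=> i; rewrite size_map => il.
  pose v0 : {ffun 'I_n -> 'I_k.+1} := [ffun=> ord0].
  rewrite (nth_map v0)//; exists (fun i' => avoid (word (nth v0 e i) i')) => //.
  by move=> i'; exists (word (nth v0 e i) i').
move=> x; have [w wP] := choice (fun i => avoid_cover (act (A i) x)).
pose v : {ffun 'I_n -> 'I_k.+1} := [ffun i => w (val i)].
have vc : v \in e by rewrite mem_enum.
exists (index v e); first by rewrite size_map index_mem.
rewrite (nth_map v) ?index_mem// nth_index// => i /= ilt.
by rewrite /preimage/= (wordE v (Ordinal ilt)) ffunE; exact: wP.
Qed.

Let le_Ncover n : (0 < n)%N ->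
  ln (k.+1%:R : R) <= n%:R^-1 * ln (fine (Ncover R (join_cover act A n cover))).
Proof.
move=> n0; set N := Ncover _ _.
have N1 : ((k.+1 ^ n)%:R%:E <= N)%E.
  by apply: le_ereal_inf_tmp => _ [s [sJ sX] <-]; rewrite lee_fin ler_nat; exact: size_join_cover.
have [s sP] := join_cover_exists n.
have N2 : (N <= (size s)%:R%:E)%E by apply: ge_ereal_inf; exists (size s)%:R%:E => //; exists s.
have Nfin : N \is a fin_num.
  rewrite fin_numE; apply/andP; split.
    by apply/eqP => NN; rewrite NN in N1.
  by apply/eqP => NN; rewrite NN in N2.
have {}N1 : (k.+1 ^ n)%:R <= fine N by rewrite -lee_fin fineK.
have n0' : 0 < n%:R :> R by rewrite ltr0n.
rewrite mulrC ler_pdivlMr// mulr_natr -lnXn// -natrX ler_ln// posrE.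
  by rewrite ltr0n expn_gt0.
by apply: lt_le_trans N1; rewrite ltr0n expn_gt0.
Qed.

Lemma ln_le_hstar_top : ((ln (k.+1%:R : R))%:E <= hstar_top R act)%E.
Proof.
apply: (@le_trans _ _ (hseq_cover R act A cover)); last first.
  apply: (@le_trans _ _ (hseq_top R act A)).
    by apply: ereal_sup_ubound; exists cover.
  by apply: ereal_sup_ubound; exists A.
rewrite /hseq_cover limn_esup_lim; apply: lime_ge; first exact: is_cvg_esups.
near=> n; apply: le_ereal_sup_tmp.
(* The index n.+1 lies in the tail from n and avoids the degenerate term at 0. *)
exists (n.+1%:R^-1 * ln (fine (Ncover R (join_cover act A n.+1 cover))))%:E.
  by exists n.+1 => //=.
by rewrite lee_fin; exact: le_Ncover.
Unshelve. all: by end_near. Qed.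

End entropy.

(** * Cardinality of the fibres *)

Section cardinality.
Variables (T : Type) (A : set T).

Lemma card_le_ordP n : `I_n #<= A <->
  exists2 p : 'I_n -> T, injective p & forall i, A (p i).
Proof.
split=> [/card_leP[f]|[p pi pA]].
  have iI (i : 'I_n) : (i : nat) \in `I_n by apply/mem_set; exact: ltn_ord.
  pose u (i : 'I_n) : set_type `I_n := SigSub (iI i).
  exists (fun i => val (f (u i))); last by move=> i; exact: set_valP.
  move=> i j /val_inj ij; apply: val_inj.
  have : u i = u j by apply: (@inj _ _ _ f) => //; rewrite inE.
  by move=> /(congr1 val).
rewrite (card_le_eql card_II).
have pK : p @` [set: 'I_n] #= [set: 'I_n].
  by apply: inj_card_eq => i j _ _; exact: pi.
rewrite -(card_le_eql pK); apply: subset_card_le.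
by move=> _ [i _ <-]; exact: pA.
Qed.

Lemma infinite_set_cardP : infinite_set A <-> forall n, `I_n #<= A.
Proof.
split=> [/infiniteP An n|An /finite_setP[n nA]].
  by apply: card_le_trans An; exact: subset_card_le.
by have := An n.+1; rewrite (card_le_eqr nA) card_le_II ltnn.
Qed.

Lemma card_eq_IP n : A #= `I_n <-> `I_n #<= A /\ ~ (`I_n.+1 #<= A).
Proof.
split=> [nA|[nA nA1]].
  by rewrite !(card_le_eqr nA) !card_le_II ltnn leqnn.
have : finite_set A.
  apply: contrapT => /infinite_set_cardP iA; exact: nA1.
move=> /finite_setP[m mA]; move: nA nA1.
rewrite !(card_le_eqr mA) !card_le_II => nm /negP; rewrite -ltnNge ltnS => mn.
by rewrite (card_eql mA); apply/card_eq_II/eqP; rewrite eqn_leq mn.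
Qed.

End cardinality.

(** * Measurability and measure of the sets of points with large fibres *)

Section multiplicity.
Variables (R : realType) (G : countZmodType) (X : pseudoMetricType R).
Variables (H : pseudoPMetricType R).
Variables (act : G -> X -> X) (actH : G -> H -> H) (pi : X -> H).
Variable nu : probability (Borel H) R.
Hypotheses (hX : Gsystem act) (mX : minimal_system act).
Hypothesis hpi : max_equicontinuous_factor act actH pi.
Hypothesis nuI : forall g (A : set (Borel H)), measurable A ->
  nu (actH g @^-1` A) = nu A.

Let hH : Gsystem actH. Proof. by have [] := hpi. Qed.
Let fpi : factor_map act actH pi. Proof. by have [] := hpi. Qed.
Let pie g x : pi (act g x) = actH g (pi x). Proof. by have [_ [_ ->]] := fpi. Qed.
Let surj y : exists x, pi x = y.
Proof.
have [_ [piT _]] := fpi.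
by have : [set: H] y by []; rewrite -piT => -[x _ <-]; exists x.
Qed.

Definition fibre_ge n : set (Borel H) :=
  [set y | `I_n #<= [set x | pi x = y]].

Lemma fibre_ge_act n g : actH g @^-1` fibre_ge n = fibre_ge n.
Proof.
have sub h y : fibre_ge n y -> fibre_ge n (actH h y).
  move=> /card_le_ordP[p pI pP]; apply/card_le_ordP.
  exists (act h \o p) => [i j /= /(congr1 (act (- h)))|i /=].
    by rewrite !(actK hX.2.1) => /pI.
  by rewrite pie pP.
apply/seteqP; split=> y; last exact: sub.
by move=> /(sub (- g)); rewrite (actK hH.2.1).
Qed.

Lemma countable_shrinking_base : exists D : nat * nat -> set X,
  (forall q, open (D q)) /\
  forall x (U : set X), nbhs x U -> exists2 q, D q x & closure (D q) `<=` U.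
Proof.
have [x0 _] := surj point.
have r0 n : 0 < n.+1%:R^-1 :> R by rewrite invr_gt0.
have net n : exists t : seq X, forall x, exists2 z, z \in t & (ball z n.+1%:R^-1)° x.
  apply: (@compact_finite_cover _ _ (fun z : X => (ball z n.+1%:R^-1)°) hX.1.2).
    by move=> z; exact: open_interior.
  by move=> x; exists x; apply: ball_interior => //; apply: ballxx; rewrite divr_gt0.
have [t tP] := choice net.
exists (fun q => (ball (nth x0 (t q.1) q.2) q.1.+1%:R^-1)°); split.
  by move=> q; exact: open_interior.
move=> x U xU; have [e e0 eU] : exists2 e : R, 0 < e & ball x e `<=` U.
  by have /nbhs_ballP[e] := xU; exists e.
have e30 : 0 < e / 3 by rewrite divr_gt0.
(* A third of [e] is enough: from x to the centre, from there to a point w' of the ball close to w,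
   and on to w. *)
have [n _ /(_ n (leqnn n))/= ne] := near_infty_natSinv_lt (PosNum e30).
have [z zt zx] := tP n x.
exists (n, index z (t n)); rewrite /= nth_index// => w wD; apply: eU.
have [w' [/interior_subset zw' ww']] := wD _ (nbhsx_ballx w _ (r0 n)).
have := ball_triangle (ball_triangle (ball_sym (interior_subset zx)) zw') (ball_sym ww').
have thrice (r : R) : r < e / 3 -> r + r + r <= e by lra.
by apply: le_ball; exact: thrice ne.
Qed.

(** The n points of a fibre are enclosed in pairs of nested base sets. The closures of the inner
    ones have closed images, which define the piece; the outer ones, with disjoint closures, serve
    as [U j]. There are countably many choices of such pairs. *)
Lemma fibre_ge_bigcup n : exists E : nat -> set H,
  [/\ fibre_ge n = \bigcup_m E m, forall m, closed (E m) &
      forall m, E m !=set0 -> exists U : 'I_n -> set X,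
        [/\ forall j, open (U j),
            forall i j x, closure (U i) x -> closure (U j) x -> i = j &
            forall j, E m `<=` pi @` U j]].
Proof.
have [D [oD DP]] := countable_shrinking_base.
pose I : countType := {ffun 'I_n -> (nat * nat) * (nat * nat)}%type.
pose ok (tau : I) := (forall j, closure (D (tau j).1) `<=` D (tau j).2) /\
  forall i j x, closure (D (tau i).2) x -> closure (D (tau j).2) x -> i = j.
pose Et (tau : I) := [set y | forall j, (pi @` closure (D (tau j).1)) y].
(* Numbers that code no admissible choice give the empty piece, whence the restriction to nonempty
   [E m] in the last clause. *)
pose E m := if unpickle m is Some tau then
  (if pselect (ok tau) then Et tau else set0) else set0.
exists E; split.
- apply/seteqP; split=> [y /card_le_ordP[p pI py]|y [m _]]; last first.
    rewrite /E; case: unpickle => // tau; case: pselect => // -[ok1 ok2] /= yE.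
    have yE' j : exists x, closure (D (tau j).1) x /\ pi x = y.
      by have [x Dx xy] := yE j; exists x.
    have [p pP] := choice yE'.
    apply/card_le_ordP; exists p; last by move=> i; have [] := pP i.
    move=> i j ij; apply: (ok2 i j (p i)).
      by apply: subset_closure; apply: ok1; have [] := pP i.
    by rewrite ij; apply: subset_closure; apply: ok1; have [] := pP j.
  have [N NP] : exists N : nat, forall ij : 'I_n * 'I_n, ij.1 != ij.2 ->
      ~ ball (p ij.1) N.+1%:R^-1 (p ij.2).
    have : \forall N \near \oo, forall ij : 'I_n * 'I_n, ij.1 != ij.2 ->
      ~ ball (p ij.1) N.+1%:R^-1 (p ij.2).
      apply: filter_forall => -[i j] /=.
      have [->|ij] := eqVneq i j; first by near=> N.
      have : exists2 e : R, 0 < e & ~ ball (p i) e (p j).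
        apply: contrapT => ne; move/eqP: ij; apply; apply: pI.
        apply: ball_eq; first exact: hX.1.1.
        by move=> e e0; apply: contrapT => nb; apply: ne; exists e.
      move=> [e e0 nb]; near=> N => _ /le_ball; apply: contra_not nb; apply.
      by apply/ltW; near: N; exact: near_infty_natSinv_lt (PosNum e0).
    by move=> /filter_ex[N NP]; exists N.
  have r0 : 0 < N.+1%:R^-1 / 2 :> R by rewrite divr_gt0// invr_gt0.
  have q2 j : exists q, D q (p j) /\ closure (D q) `<=` ball (p j) (N.+1%:R^-1 / 2).
    by have [q qp qb] := DP (p j) _ (nbhsx_ballx (p j) _ r0); exists q.
  have [f2 f2P] := choice q2.
  have q1 j : exists q, D q (p j) /\ closure (D q) `<=` D (f2 j).
    have [|q qp qb] := DP (p j) (D (f2 j)); last by exists q.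
    by apply: open_nbhs_nbhs; split=> //; have [] := f2P j.
  have [f1 f1P] := choice q1.
  pose tau : I := [ffun j => (f1 j, f2 j)].
  exists (pickle tau) => //; rewrite /E pickleK; case: pselect => [okt /=|]; last first.
    case; split=> [j|i j x]; first by rewrite ffunE; have [] := f1P j.
    rewrite !ffunE /= => ix jx; apply/eqP; apply: contrapT => /negP ij.
    apply: (NP (i, j) ij) => /=.
    by apply: (@ball_splitl _ _ x); [exact: (f2P i).2|exact: (f2P j).2].
  move=> j; exists (p j); last exact: py.
  by rewrite ffunE; apply: subset_closure; have [] := f1P j.
- move=> m; rewrite /E; case: unpickle => [tau|]; last exact: closed0.
  case: pselect => [okt|nok] /=; last exact: closed0.
  apply: (closed_forall (f := fun j => pi @` closure (D (tau j).1))) => j.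
  by apply: (factor_image_closed hX hH fpi); exact: closed_closure.
- move=> m [y]; rewrite /E; case: unpickle => // tau; case: pselect => // -[ok1 ok2] /= _.
  exists (fun j => D (tau j).2); split=> // j z /(_ j)[x Dx <-].
  by exists x => //; exact: ok1.
Unshelve. all: by end_near. Qed.

Lemma measurable_fibre_ge n : measurable (fibre_ge n).
Proof.
have [E [-> cE _]] := fibre_ge_bigcup n.
by apply: bigcupT_measurable => m; exact: borel_closed.
Qed.

Lemma fibre_ge_piece n : 0 < pr nu (fibre_ge n) -> exists (E : set H),
  [/\ closed E, E `<=` fibre_ge n, 0 < pr nu E &
      exists U : 'I_n -> set X,
        [/\ forall j, open (U j),
            forall i j x, closure (U i) x -> closure (U j) x -> i = j &
            forall j, E `<=` pi @` U j]].
Proof.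
have [E [FE cE EP]] := fibre_ge_bigcup n; rewrite FE => F0.
have mE m : measurable (E m : set (Borel H)) by exact: borel_closed.
have [m Em] : exists m, 0 < pr nu (E m).
  apply: contrapT => nE; move: F0; rewrite /pr measure_negligible ?ltxx//.
    exact: bigcupT_measurable.
  apply: negligible_bigcup => m; apply/negligibleP => //.
  apply: (etrans (prE nu (mE m))); congr EFin; apply/eqP; rewrite eq_le pr_ge0 andbT leNgt.
  by apply/negP => Em; apply: nE; exists m.
exists (E m); split=> //; first by move=> y Ey; exists m.
apply: EP; apply/set0P/eqP => E0; move: Em.
by rewrite E0 /pr measure0 ltxx.
Qed.

Let mH : minimal_system actH. Proof. exact: factor_minimal mX fpi. Qed.
Let eqH : equicontinuous_system actH.
Proof. exact: max_factor_equicontinuous hX hpi. Qed.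

Lemma fibre_ge_full n : 0 < pr nu (fibre_ge n) -> pr nu (fibre_ge n) = 1.
Proof.
move=> /fibre_ge_piece[E [cE EF E0 _]].
apply: (ergodic hH mH eqH nuI _ _ cE) => //; first exact: measurable_fibre_ge.
exact: fibre_ge_act.
Qed.

Lemma fibre_ge_entropy n : 0 < pr nu (fibre_ge n.+1) ->
  ((ln (n.+1%:R : R))%:E <= hstar_top R act)%E.
Proof.
move=> /fibre_ge_piece[E [cE _ E0 [U [oU dU EU]]]].
have [A AP] := independent_sequence hX mX hpi nuI oU cE E0 EU.
exact: ln_le_hstar_top dU AP.
Qed.

Lemma fibre_ge1 : fibre_ge 1 = setT.
Proof.
apply/seteqP; split=> // y _; apply/card_le_ordP.
by have [x xy] := surj y; exists (fun=> x) => // i j; rewrite !ord1.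
Qed.

Lemma fibre_card_some n :
  fibre_card pi ^~ (Some n) = fibre_ge n `\` fibre_ge n.+1 :> set (Borel H).
Proof. by apply/seteqP; split=> y; move/card_eq_IP. Qed.

Lemma fibre_card_none :
  fibre_card pi ^~ None = \bigcap_n fibre_ge n :> set (Borel H).
Proof.
apply/seteqP; split=> y; first by move=> /infinite_set_cardP yP n _; exact: yP.
by move=> yP; apply/infinite_set_cardP => n; exact: yP.
Qed.

End multiplicity.

Theorem theorem1p1 (R : realType) (G : countZmodType) (X : pseudoMetricType R) (H : pseudoPMetricType R)
  (act : G -> X -> X) (actH : G -> H -> H) (pi : X -> H)
  (nu : probability (Borel H) R) :
  infinite_set [set: G] ->
  Gsystem act -> minimal_system act ->
  max_equicontinuous_factor act actH pi ->
  (forall g (A : set (Borel H)), measurable A -> nu (actH g @^-1` A) = nu A) ->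
  exists K : option nat,
    (logK R K <= hstar_top R act)%E /\
    measurable [set y : Borel H | fibre_card pi y K] /\
    nu [set y : Borel H | fibre_card pi y K] = 1%E.
Proof.
move=> _ hX mX hpi nuI.
have mF n := measurable_fibre_ge hX hpi n.
have full n := fibre_ge_full (n := n) hX mX hpi nuI.
have ent n := fibre_ge_entropy (n := n) hX mX hpi nuI.
have [all_pos|/existsNP[n0 n0P]] :=
  pselect (forall n, 0 < pr nu (fibre_ge pi n)).
  exists None; split; [|split].
  (* The entropy bounds ln(n+1) for every n, so it cannot be a real r: take n + 1 above exp r. *)
  - have ln_le n := ent n (all_pos n.+1).
    case: (hstar_top R act) ln_le => [r| |] //= ln_le; last by have := ln_le 0%N.
    have := ln_le (Num.truncn (expR r)); rewrite lee_fin => lnr.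
    have : expR r < (Num.truncn (expR r)).+1%:R by exact: truncnS_gt.
    by rewrite -ltr_ln ?posrE ?expR_gt0// expRK ltNge lnr.
  - rewrite [mkset _](fibre_card_none pi).
    exact: bigcap_measurableType.
  rewrite [mkset _](fibre_card_none pi).
  have mcap : measurable (\bigcap_n fibre_ge pi n) by exact: bigcap_measurableType.
  have : nu (~` \bigcap_n fibre_ge pi n) = 0%E.
    rewrite setC_bigcap; apply: measure_negligible.
      by apply: bigcupT_measurable => n; exact: measurableC.
    apply: negligible_bigcup => n; apply/negligibleP; first exact: measurableC.
    apply: (etrans (probability_setC nu (mF n))).
    by rewrite prE// full// subee.
  by rewrite probability_setC// => /eqP; rewrite sube_eq// ?add0e => /eqP.
have ex0 : exists n, pr nu (fibre_ge pi n) <= 0.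
  by exists n0; rewrite leNgt; exact/negP.
case: (ex_minnP ex0) => m m0 mmin.
(* Every fibre has at least one point, so the least index [m] of measure zero is at least 2, and K =
   m - 1. *)
have [n mn] : exists n, m = n.+2.
  have one : pr nu [set: Borel H] <= 0 -> False by rewrite prT ler10.
  move: m m0 {mmin} => [|[|n]] m0; last by exists n.
    exfalso; apply: one; apply: le_trans m0; apply: pr_le => // y _.
    by rewrite /fibre_ge/= II0; exact: card_ge0.
  by exfalso; apply: one; rewrite -(fibre_ge1 hpi).
have npos : 0 < pr nu (fibre_ge pi n.+1).
  by rewrite ltNge; apply/negP => /mmin; rewrite mn ltnn.
exists (Some n.+1); rewrite [mkset _](fibre_card_some pi).
have mD : measurable (fibre_ge pi n.+1 `\` fibre_ge pi n.+2) by exact: measurableD.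
split; first exact: ent; split=> //.
rewrite prE// prD//; last first.
  move=> y; apply: card_le_trans; rewrite card_le_II; exact: leqnSn.
congr EFin; rewrite full// -mn; apply/eqP; rewrite subr_eq addrC -subr_eq subrr eq_sym.
by rewrite eq_le m0 pr_ge0.
Qed.
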